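(* Let $\mathcal{C}$ be a type I self-dual Weyl tensor and let $\Psi_0,\dots,\Psi_4$ be its components in an arbitrary null bivector base $\{\mathbf{W},\mathbf{U},\mathbf{V}\}$. Then the principal transverse bivector bases $\{\mathbf{W}_i,\mathbf{U}_i,\mathbf{V}_i\}$ of $\mathcal{C}$ can be obtained as $$\mathbf{W}_i=\mathbf{W}_i,\qquad \mathbf{U}_i=\tfrac{\mathrm{i}}2(\mathbf{W}_j+\mathrm{i}\mathbf{W}_k),\qquad \mathbf{V}_i=\tfrac{\mathrm{i}}2(\mathbf{W}_j-\mathrm{i}\mathbf{W}_k),$$ where $(i,j,k)$ runs over the cyclic permutations of $(1,2,3)$ and $\{\mathbf{W}_1,\mathbf{W}_2,\mathbf{W}_3\}$ is the oriented eigenframe of principal 2-forms given (by a formula stated for a non transverse base $\{\mathbf{W},\mathbf{U},\mathbf{V}\}$) by $$\mathbf{W}_i=\frac{1}{\sqrt{D_iC_i}}\big(A_i\mathbf{U}+B_i\mathbf{W}+C_i\mathbf{V}\big),\qquad i=1,2,3.$$ Here $$A_i=\Psi_0\Psi_4+\Psi_2^2-2\Psi_1\Psi_3+\alpha_i\Psi_2+(\alpha_i^2-I),\qquad B_i=\Psi_1\Psi_4-\Psi_2\Psi_3+\Psi_3\alpha_i,$$ $$C_i=2\Psi_2\Psi_4-2\Psi_3^2+\alpha_i\Psi_4,\qquad D_i=\tfrac12(I-3\alpha_i^2),$$ $$\alpha_1=\beta+\frac{I}{3\beta},\qquad \alpha_2=-\tfrac12\Big((1-\mathrm{i}\sqrt3)\beta+(1+\mathrm{i}\sqrt3)\frac{I}{3\beta}\Big),\qquad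 \alpha_3=-\tfrac12\Big((1+\mathrm{i}\sqrt3)\beta+(1-\mathrm{i}\sqrt3)\frac{I}{3\beta}\Big),$$ $$I = \Psi_0\Psi_4-4\Psi_1\Psi_3+3\Psi_2^2,\qquad J=\begin{vmatrix}\Psi_4&\Psi_3&\Psi_2\\ \Psi_3&\Psi_2&\Psi_1\\ \Psi_2&\Psi_1&\Psi_0\end{vmatrix},\qquad \beta=\sqrt[3]{J+\sqrt{J^2-I^3/27}},$$ where $\beta$ is a particular non-zero value of this root.
   Context: Everything is pointwise on an oriented, time-oriented 4-dimensional spacetime with metric $g$ of signature $(-+++)$ and volume element $\eta$. Self-dual 2-forms. $X$ is self-dual if $*X=\mathrm{i}X$, $*$ the Hodge dual. On the 3-dimensional complex space of self-dual 2-forms use the metric $(X,Y)=\frac12X_{\alpha\beta}Y^{\alpha\beta}$, i.e. the metric $\mathcal{G}=\frac12(G-\mathrm{i}\eta)$, $G$ being the usual metric on 2-forms. A unitary self-dual 2-form satisfies $(X,X)=-1$. The product of 2-forms is $(A\times B)_{\alpha\beta}=A_\alpha{}^{\lambda}B_{\lambda\beta}$, and $a\wedge b=a\otimes b-b\otimes a$. Weyl tensor. The self-dual Weyl tensor is $\mathcal{C}=\frac12(C-\mathrm{i}*C)$, $C$ the Weyl tensor, regarded as a trace-free, $(\cdot,\cdot)$-symmetric endomorphism of the space of self-dual 2-forms; $(A\otimes B)(X)=A\,(B,X)$. Its characteristic equation is $x^3-Ix-2J=0$ with $I=\frac12\operatorname{tr}\mathcal{C}^2$, $J=\frac16\operatorname{tr}\mathcal{C}^3$.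 Type I means that the three roots $\alpha_1,\alpha_2,\alpha_3$ are distinct, equivalently $27J^2\neq I^3$. Then there are unitary, mutually orthogonal eigenvectors $\mathbf{W}_i$, $\mathcal{C}(\mathbf{W}_i)=\alpha_i\mathbf{W}_i$, called principal 2-forms, unique up to sign, with $\mathcal{C}=-\sum_i\alpha_i\mathbf{W}_i\otimes\mathbf{W}_i$. The eigenframe $\{\mathbf{W}_i\}$ is oriented if $\mathbf{W}_3=\mathrm{i}\sqrt2\,\mathbf{W}_1\times\mathbf{W}_2$; the signs of the square roots $\sqrt{D_iC_i}$ are chosen accordingly. Null frames and components. A null tetrad $\{l,k,m,\bar m\}$ has $l,k$ real future-pointing null vectors, $m$ complex null, $l\cdot k=-1$, $m\cdot\bar m=1$, other products zero. Its associated null bivector base is $\mathbf{W}=\frac1{\sqrt2}(l\wedge k+m\wedge\bar m)$, $\mathbf{U}=-\frac1{\sqrt2}l\wedge\bar m$, $\mathbf{V}=\frac1{\sqrt2}k\wedge m$, the tetrad being oriented so that these are self-dual (so $(\mathbf{W},\mathbf{W})=-1$, $(\mathbf{U},\mathbf{V})=\frac12$, other products zero). The components $\Psi_a$ are defined by $$\tfrac12\mathcal{C}=\Psi_0\mathbf{U}\otimes\mathbf{U}+\Psi_1\mathbf{U}\tilde\otimes\mathbf{W}+\Psi_2(\mathbf{U}\tilde\otimes\mathbf{V}+\mathbf{W}\otimes\mathbf{W})+\Psi_3\mathbf{W}\tilde\otimes\mathbf{V}+\Psi_4\mathbf{V}\otimes\mathbf{V},$$ with $A\tilde\otimes B=A\otimes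 B+B\otimes A$. The base (or tetrad) is transverse if $\Psi_1=\Psi_3=0$, and non transverse otherwise. Principal transverse bivector base. This is a transverse null bivector base (with inner products $(\mathbf{W},\mathbf{W})=-1$, $(\mathbf{U},\mathbf{V})=\frac12$, other products zero, where $\mathbf{W},\mathbf{U},\mathbf{V}$ here denote its first, second and third elements) in which, moreover, $\Psi_0=\Psi_4$; its first element is a principal 2-form. The three oriented ones, one for each eigenvalue $\alpha_i$, are denoted $\{\mathbf{W}_i,\mathbf{U}_i,\mathbf{V}_i\}$; they are considered up to the choice of the oriented eigenframe $\{\mathbf{W}_i\}$ (changes of sign, and interchange of $\mathbf{U}_i$ and $\mathbf{V}_i$ with a change of sign). (The roman $\mathrm{i}$ is the imaginary unit; the italic subscript $i$ is an index.)
   Formalization: The formula for W_i is asserted only when D_iC_i≠0 (it can be 0/0 in a non transverse base, e.g. Ψ=(2,1,1,1,1), α=0; orientation then fixes W_i); and a base with Ψ0=Ψ4 may also come from the oriented frame (W_i,−W_k,W_j), i.e. (iU_i,−iV_i). *)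

(* Defs.v *)
From mathcomp Require Import all_boot all_order all_algebra.
From mathcomp Require Export complex.

Set Implicit Arguments.
Unset Strict Implicit.
Unset Printing Implicit Defensive.

Import Order.TTheory GRing.Theory Num.Theory.
Local Open Scope ring_scope.
Local Open Scope complex_scope.

(* The tangent space at a point is 'rV[R]_4, through an arbitrary basis. Vectors
   are row vectors (complex ones over R[i]); a covariant 2-tensor X is the matrix
   of its components X_{ab}. *)

Section Geometry.
Variable R : rcfType.
Local Notation C := R[i].

Definition toC m n (A : 'M[R]_(m, n)) : 'M[C]_(m, n) :=
  map_mx (fun x => x%:C) A.

Definition minkowski : 'M[R]_4 := diag_mx (\row_j (if j == 0 then -1 else 1)).

(* The time orientation is the choice of a timelike vector, declared to be
   future-pointing. *)
Record spacetime_point := SpacetimePoint {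
  metric : 'M[R]_4;
  metric_signature :
    exists2 P : 'M[R]_4, P \in unitmx & metric = P^T *m minkowski *m P;
  positive_basis : bool;
  future : 'rV[R]_4;
  future_timelike : (future *m metric *m future^T) 0 0 < 0 }.

Variable p : spacetime_point.

Local Notation g := (toC (metric p)).
Local Notation ginv := (toC (invmx (metric p))).

Definition dot (u v : 'rV[C]_4) : C := (u *m g *m v^T) 0 0.

Definition future_pointing (v : 'rV[R]_4) : Prop :=
  (v *m metric p *m (future p)^T) 0 0 < 0.

Definition levi_civita (a b c d : 'I_4) : R :=
  \det (\matrix_(i < 4, j < 4) (nth 0 [:: a; b; c; d] i == j)%:R).

Definition eta (a b c d : 'I_4) : R :=
  (if positive_basis p then 1 else -1) * Num.sqrt (- \det (metric p))
    * levi_civita a b c d.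

(* X^{ab} *)
Definition raise (X : 'M[C]_4) : 'M[C]_4 := ginv *m X *m ginv^T.

Definition hodge (X : 'M[C]_4) : 'M[C]_4 :=
  \matrix_(a, b) (2^-1 * \sum_c \sum_d (eta a b c d)%:C * raise X c d).

Definition self_dual (X : 'M[C]_4) : Prop := X^T = - X /\ hodge X = 'i *: X.

(* (X, Y) = 1/2 X_{ab} Y^{ab} *)
Definition ip (X Y : 'M[C]_4) : C :=
  2^-1 * \sum_a \sum_b X a b * raise Y a b.

(* (A x B)_{ab} = A_a^c B_{cb} *)
Definition cross (A B : 'M[C]_4) : 'M[C]_4 := A *m ginv *m B.

(* The 2-form (a /\ b)_{ab} of two vectors, with indices lowered by g. *)
Definition wedge (a b : 'rV[C]_4) : 'M[C]_4 :=
  (a *m g)^T *m (b *m g) - (b *m g)^T *m (a *m g).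

Definition tensor4 (K : Type) := 'I_4 -> 'I_4 -> 'I_4 -> 'I_4 -> K.

Definition is_weyl (T : tensor4 R) : Prop :=
  [/\ forall a b c d, T b a c d = - T a b c d,
      forall a b c d, T c d a b = T a b c d,
      forall a b c d, T a b c d + T a c d b + T a d b c = 0
    & forall b d, \sum_a \sum_c invmx (metric p) a c * T a b c d = 0].

Variable T : tensor4 R.

(* 1/2 (C - i *C), with * acting on the first pair of indices. *)
Definition sd_weyl : tensor4 C := fun a b c d =>
  2^-1 * ((T a b c d)%:C - 'i * hodge (\matrix_(e, f) (T e f c d)%:C) a b).

(* X |-> 1/2 C_{abcd} X^{cd}; the factor 1/2 is the one for which A (x) B acts
   as X |-> (B, X) A. *)
Definition sd_weyl_op (X : 'M[C]_4) : 'M[C]_4 :=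
  \matrix_(a, b) (2^-1 * \sum_c \sum_d sd_weyl a b c d * raise X c d).

(* sd_weyl_op takes values in the self-dual 2-forms (for a Weyl tensor), so the
   trace of its powers over all covariant 2-tensors is their trace over the
   self-dual 2-forms. *)
Definition trI : C := 2^-1 * \tr (lin_mx (sd_weyl_op \o sd_weyl_op)).
Definition trJ : C :=
  6^-1 * \tr (lin_mx (sd_weyl_op \o sd_weyl_op \o sd_weyl_op)).

Definition type_I : Prop :=
  exists2 x : 'I_3 -> C, injective x
    & forall n, x n ^+ 3 - trI * x n - 2 * trJ = 0.

Definition null_tetrad (l k : 'rV[R]_4) (m : 'rV[C]_4) : Prop :=
  [/\ future_pointing l, future_pointing k,
      [/\ dot (toC l) (toC l) = 0, dot (toC k) (toC k) = 0 & dot m m = 0],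
      dot (toC l) (toC k) = -1 /\ dot m (map_mx conjc m) = 1
    & dot (toC l) m = 0 /\ dot (toC k) m = 0].

Definition null_bivector_base (W U V : 'M[C]_4) : Prop :=
  exists l k m, [/\ null_tetrad l k m,
    W = (Num.sqrt 2)^-1%:C *:
          (wedge (toC l) (toC k) + wedge m (map_mx conjc m)),
    U = - (Num.sqrt 2)^-1%:C *: wedge (toC l) (map_mx conjc m),
    V = (Num.sqrt 2)^-1%:C *: wedge (toC k) m
  & [/\ self_dual W, self_dual U & self_dual V]].

Record weyl_scalars := WeylScalars { Psi0 : C; Psi1 : C; Psi2 : C; Psi3 : C; Psi4 : C }.

Definition otimes (A B : 'M[C]_4) : tensor4 C := fun a b c d => A a b * B c d.
Definition sotimes (A B : 'M[C]_4) : tensor4 C := fun a b c d =>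
  otimes A B a b c d + otimes B A a b c d.

Definition components (W U V : 'M[C]_4) (Psi : weyl_scalars) : Prop :=
  forall a b c d,
    2^-1 * sd_weyl a b c d =
      Psi0 Psi * otimes U U a b c d
    + Psi1 Psi * sotimes U W a b c d
    + Psi2 Psi * (sotimes U V a b c d + otimes W W a b c d)
    + Psi3 Psi * sotimes W V a b c d
    + Psi4 Psi * otimes V V a b c d.

Definition transverse (Psi : weyl_scalars) : Prop := Psi1 Psi = 0 /\ Psi3 Psi = 0.

(* Being associated with a null tetrad, such a base satisfies
   W = sqrt 2 (U x V - V x U): these are the oriented bases. *)
Definition principal_transverse_base (W U V : 'M[C]_4) : Prop :=
  null_bivector_base W U V /\
  exists Psi, [/\ components W U V Psi, transverse Psi & Psi0 Psi = Psi4 Psi].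

Definition eigenframe (alpha : 'I_3 -> C) (w : 'I_3 -> 'M[C]_4) : Prop :=
  [/\ forall n, self_dual (w n),
      forall n, ip (w n) (w n) = -1,
      forall m n, m != n -> ip (w m) (w n) = 0
    & forall n, sd_weyl_op (w n) = alpha n *: w n].

Definition oriented (w : 'I_3 -> 'M[C]_4) : Prop :=
  w 2 = ('i * (Num.sqrt 2)%:C) *: cross (w 0) (w 1).

Definition transverseU (X Y : 'M[C]_4) : 'M[C]_4 := ('i / 2) *: (X + 'i *: Y).
Definition transverseV (X Y : 'M[C]_4) : 'M[C]_4 := ('i / 2) *: (X - 'i *: Y).

Section Scalars.
Variable Psi : weyl_scalars.
Local Notation P0 := (Psi0 Psi).
Local Notation P1 := (Psi1 Psi).
Local Notation P2 := (Psi2 Psi).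
Local Notation P3 := (Psi3 Psi).
Local Notation P4 := (Psi4 Psi).

Definition invI : C := P0 * P4 - 4 * P1 * P3 + 3 * P2 ^+ 2.

(* Rows (P4, P3, P2), (P3, P2, P1), (P2, P1, P0). *)
Definition invJ : C :=
  \det (\matrix_(i < 3, j < 3) nth 0 [:: P4; P3; P2; P1; P0] (i + j)).

(* beta is one of the values of the nested root (any square root, any cube root). *)
Definition is_beta (beta : C) : Prop :=
  exists2 s : C, s ^+ 2 = invJ ^+ 2 - invI ^+ 3 / 27 & beta ^+ 3 = invJ + s.

Definition alpha (beta : C) (n : 'I_3) : C :=
  let r3 := 'i * (Num.sqrt 3)%:C in
  nth 0 [:: beta + invI / (3 * beta);
            - 2^-1 * ((1 - r3) * beta + (1 + r3) * (invI / (3 * beta)));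
            - 2^-1 * ((1 + r3) * beta + (1 - r3) * (invI / (3 * beta)))] n.

Definition coefA (a : C) : C :=
  P0 * P4 + P2 ^+ 2 - 2 * P1 * P3 + a * P2 + (a ^+ 2 - invI).
Definition coefB (a : C) : C := P1 * P4 - P2 * P3 + P3 * a.
Definition coefC (a : C) : C := 2 * P2 * P4 - 2 * P3 ^+ 2 + a * P4.
Definition coefD (a : C) : C := 2^-1 * (invI - 3 * a ^+ 2).

(* X = (A U + B W + C V) / sqrt (D C), for some value of the square root. This is
   required only when D C != 0: in a transverse base, and also in a non
   transverse one with U orthogonal to a principal 2-form, there is one
   eigenvalue for which A = B = C = 0 and the quotient is meaningless. *)
Definition principal_formula (W U V : 'M[C]_4) (a : C) (X : 'M[C]_4) : Prop :=
  coefD a * coefC a != 0 ->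
  exists2 r : C, r ^+ 2 = coefD a * coefC a
    & X = r^-1 *: (coefA a *: U + coefB a *: W + coefC a *: V).

End Scalars.
End Geometry.

(* Main.v *)
Require Import Defs.
From mathcomp Require Import all_boot all_order all_algebra ring.

Set Implicit Arguments.
Unset Strict Implicit.
Unset Printing Implicit Defensive.

Import Order.TTheory GRing.Theory Num.Theory.
Local Open Scope ring_scope.
Local Open Scope complex_scope.

(** A null bivector base is orthogonal up to scale, so a self-dual 2-form is a
    triple of coordinates (a, b, c), meaning a U + b W + c V, on which the metric,
    the product, the Weyl tensor and hence I, J become explicit. Since
    C^2 + alpha C + (alpha^2 - I) maps onto the eigenspace of the root alpha, its
    value (A, B, C) at U is an eigenvector; self-adjointness gives it the norm
    - D C. At most one of the C_i vanishes, and the third vector of an oriented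
    frame is the vector product of the other two. Finally, a pair of null
    self-dual 2-forms with product 1/2 has coordinates (x^2, x y, y^2) and
    (z^2, z t, t^2) with x t - y z = 1, that is, it comes from a unimodular change
    of spinor frame, which also transforms the null tetrad. *)

(** The triples (A_i, B_i, C_i) cannot define the frame outright: one of them may be zero, at an
    index that depends on the Weyl tensor. Frames are therefore anchored at an arbitrary index [i],
    with the others reached by [ordS]; the formula gives the members other than [i], and
    tracelessness makes their product an eigenvector for the remaining root. A null bivector base is
    more than three self-dual 2-forms with the right inner products: it must come from real
    future-pointing [l] and [k]. Hence the lift to spinors: SL(2, C) acts on self-dual 2-forms by
    complex rotations and on tangent vectors by Lorentz transformations preserving orientation and
    time orientation, so the required tetrad can be written down. For the converse, I and J are
    traces, hence the same in every base: the eigenvalues read off in a transverse base are, up to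
    order, the roots computed from the given scalars. *)

Lemma det_mx33 (K : comNzRingType) (M : 'M[K]_3) :
  \det M = M 0 0 * (M 1 1 * M 2 2 - M 1 2 * M 2 1)
         - M 0 1 * (M 1 0 * M 2 2 - M 1 2 * M 2 0)
         + M 0 2 * (M 1 0 * M 2 1 - M 1 1 * M 2 0).
Proof.
pose N a b := M (inord a) (inord b).
have -> : M = \matrix_(i, j) N i j.
  by apply/matrixP => i j; rewrite mxE /N !inord_val.
rewrite (expand_det_row _ 0) 3!big_ord_recl big_ord0 /cofactor.
rewrite !(expand_det_row _ 0) !big_ord_recl !big_ord0 /cofactor !det_mx11.
rewrite !mxE /= /bump /=; ring.
Qed.

Lemma ordS3 (i : 'I_3) : ordS (ordS (ordS i)) = i.
Proof. by apply/val_inj; case: i => [[|[|[|]]]]. Qed.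

Lemma ordS_neq (i : 'I_3) : ordS i != i.
Proof. by case: i => [[|[|[|]]]]. Qed.

Lemma ordSS_neq (i : 'I_3) : ordS (ordS i) != i.
Proof. by case: i => [[|[|[|]]]]. Qed.

Lemma ord3_ind (i : 'I_3) (P : 'I_3 -> Prop) :
  P i -> P (ordS i) -> P (ordS (ordS i)) -> forall n, P n.
Proof.
move=> h0 h1 h2 n.
have : [|| n == i, n == ordS i | n == ordS (ordS i)].
  by case: i n {h0 h1 h2} => [[|[|[|]]] ?] // [[|[|[|]]] ?].
by case/or3P => /eqP ->.
Qed.

Lemma ordS30 : ordS 0 = 1 :> 'I_3. Proof. exact/val_inj. Qed.
Lemma ordS31 : ordS 1 = 2 :> 'I_3. Proof. exact/val_inj. Qed.
Lemma ordS32 : ordS 2 = 0 :> 'I_3. Proof. exact/val_inj. Qed.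
Definition ordS3E := (ordS30, ordS31, ordS32).

Lemma ord3P (P : 'I_3 -> Prop) : P 0 -> P 1 -> P 2 -> forall n, P n.
Proof. by move=> h0 h1 h2; apply: (@ord3_ind 0); rewrite ?ordS3E. Qed.

(** * Self-dual 2-forms in coordinates *)

Section Coordinates.
Variables (R : rcfType) (j : R[i]) (Psi : weyl_scalars R).
(* [j] is to be ['i], which unfolds to a pair, so that [ring] could not use its
   square. *)
Hypothesis j2 : j ^+ 2 = -1.
Local Notation C := R[i].
Local Notation vec := (C * C * C)%type.
Local Notation coefB := Defs.coefB.
Local Notation coefC := Defs.coefC.
Local Notation coefD := Defs.coefD.
Local Notation P0 := (Psi0 Psi).
Local Notation P1 := (Psi1 Psi).
Local Notation P2 := (Psi2 Psi).
Local Notation P3 := (Psi3 Psi).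
Local Notation P4 := (Psi4 Psi).

Lemma two_neq0 : 2 != 0 :> C.
Proof. by rewrite pnatr_eq0. Qed.

Lemma invJE :
  invJ Psi = P4 * (P2 * P0 - P1 ^+ 2) - P3 * (P3 * P0 - P1 * P2)
           + P2 * (P3 * P1 - P2 ^+ 2).
Proof.
rewrite /invJ det_mx33 !mxE.
have -> : nat_of_ord (2 : 'I_3) = 2 by [].
by rewrite /= !expr2.
Qed.

(* (a, b, c) stands for a U + b W + c V. *)
Definition ip3 (x y : vec) : C :=
  2^-1 * (x.1.1 * y.2 + x.2 * y.1.1) - x.1.2 * y.1.2.

(* i sqrt 2 times half the commutator for [cross]. *)
Definition vee (x y : vec) : vec :=
  (j * (x.1.1 * y.1.2 - x.1.2 * y.1.1),
   j / 2 * (x.1.1 * y.2 - x.2 * y.1.1),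
   j * (x.1.2 * y.2 - x.2 * y.1.2)).

Definition scale3 (a : C) (x : vec) : vec := (a * x.1.1, a * x.1.2, a * x.2).
Definition add3 (x y : vec) : vec :=
  (x.1.1 + y.1.1, x.1.2 + y.1.2, x.2 + y.2).

(** The coefficients come from (U, X) = c/2, (W, X) = -b, (V, X) = a/2 for X = a U + b W + c V,
    doubled because [components] expands half of the Weyl tensor. *)
Definition weyl3 (x : vec) : vec :=
  (P0 * x.2 - 2 * P1 * x.1.2 + P2 * x.1.1,
   P1 * x.2 - 2 * P2 * x.1.2 + P3 * x.1.1,
   P2 * x.2 - 2 * P3 * x.1.2 + P4 * x.1.1).

Lemma ip3C x y : ip3 x y = ip3 y x.
Proof. by rewrite /ip3; ring. Qed.

Lemma ip3Zl a x y : ip3 (scale3 a x) y = a * ip3 x y.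
Proof. by rewrite /ip3/=; ring. Qed.

Lemma ip3Zr a x y : ip3 x (scale3 a y) = a * ip3 x y.
Proof. by rewrite ip3C ip3Zl ip3C. Qed.

(** Gram determinant identity. The factor [j] in [vee] fixes the sign, so that orthogonal vectors of
    norm -1 have a product of norm -1. *)
Lemma ip3_vee x y :
  ip3 (vee x y) (vee x y) = ip3 x y ^+ 2 - ip3 x x * ip3 y y.
Proof. rewrite /ip3/=; by field: j2. Qed.

Lemma ip3_veel x y : ip3 (vee x y) x = 0.
Proof. by rewrite /ip3/=; ring. Qed.

Lemma ip3_veer x y : ip3 (vee x y) y = 0.
Proof. by rewrite /ip3/=; ring. Qed.

Lemma vee_veel x y :
  vee (vee x y) x = add3 (scale3 (- ip3 x x) y) (scale3 (ip3 x y) x).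
Proof.
rewrite /vee /add3 /scale3 /ip3 /=; do ![congr (_, _)]; by field: j2.
Qed.

Lemma vee_veer x y :
  vee y (vee x y) = add3 (scale3 (- ip3 y y) x) (scale3 (ip3 x y) y).
Proof.
rewrite /vee /add3 /scale3 /ip3 /=; do ![congr (_, _)]; by field: j2.
Qed.

(** Cramer's rule, the triple product being a volume form. *)
Lemma ip3_expand x a b c :
  scale3 (ip3 (vee a b) c) x =
  add3 (scale3 (ip3 x (vee b c)) a)
    (add3 (scale3 (ip3 x (vee c a)) b) (scale3 (ip3 x (vee a b)) c)).
Proof.
rewrite /vee /add3 /scale3 /ip3 /=; do ![congr (_, _)]; by field: j2.
Qed.

Lemma weyl3_sym x y : ip3 (weyl3 x) y = ip3 x (weyl3 y).
Proof. rewrite /ip3/=; by field. Qed.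

(** For a symmetric operator S in dimension 3, the sum of S(x v y), Sx v y and x v Sy is tr(S) times
    x v y; here the trace is zero. *)
Lemma weyl3_vee x y :
  weyl3 (vee x y) =
  add3 (scale3 (-1) (vee (weyl3 x) y)) (scale3 (-1) (vee x (weyl3 y))).
Proof.
rewrite /weyl3 /vee /add3 /scale3 /ip3 /=; do ![congr (_, _)]; by field.
Qed.

(* The image of U under C^2 + a C + (a^2 - I), the characteristic polynomial
   divided by x - a. *)
Definition principal3 a : vec := (coefA Psi a, coefB Psi a, coefC Psi a).

Definition is_root (a : C) := a ^+ 3 = invI Psi * a + 2 * invJ Psi.

Lemma weyl3_principal a :
  is_root a -> weyl3 (principal3 a) = scale3 a (principal3 a).
Proof.
rewrite /is_root invJE /weyl3 /principal3 /scale3 /=.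
rewrite /coefA /coefB /coefC /invI => h.
do ![congr (_, _)]; ring: h.
Qed.

(** Let q = C^2 + a C + (a^2 - I). On its image C acts as a, so q acts as 3 a^2 - I = -2 D; hence
    (qU, qU) = (U, q(qU)) = -2 D (U, qU), and (U, qU) is half the V-coordinate of qU. *)
Lemma ip3_principal a : is_root a ->
  ip3 (principal3 a) (principal3 a) = - (coefD Psi a * coefC Psi a).
Proof.
rewrite /is_root invJE /ip3 /principal3 /=.
rewrite /coefA /coefB /coefC /coefD /invI => h.
by field: h.
Qed.

(** * The three roots, by Cardano's formulas *)

Section Roots.
Variable beta : C.
Hypotheses (is_beta_beta : is_beta Psi beta) (beta_neq0 : beta != 0).
Local Notation al := (alpha Psi beta).
Local Notation I := (invI Psi).
Local Notation J := (invJ Psi).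

(** Hides the division by [beta]: with b = beta and c = I/(3 beta), later identities are polynomial
    in b, c and r, where (-1 + r)/2 is a primitive cube root of unity. The second relation holds
    because c^3 = (J^2 - s^2)/(J + s) = J - s. *)
Lemma cardanoE : exists b c r : C,
  [/\ [/\ b * c = I / 3, b ^+ 3 + c ^+ 3 = 2 * J & r ^+ 2 = - 3],
      al 0 = b + c,
      al 1 = - 2^-1 * ((1 - r) * b + (1 + r) * c)
    & al 2 = - 2^-1 * ((1 + r) * b + (1 - r) * c)].
Proof.
have [s s2 b3] := is_beta_beta.
exists beta, (I / (3 * beta)), ('i * (Num.sqrt 3)%:C); split=> //.
split.
- by field; rewrite beta_neq0.
- have -> : (I / (3 * beta)) ^+ 3 = J - s.
    have b30 : beta ^+ 3 != 0 by rewrite expf_neq0.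
    apply: (mulfI b30).
    have -> : beta ^+ 3 * (I / (3 * beta)) ^+ 3 = I ^+ 3 / 27.
      by field; rewrite beta_neq0.
    have -> : I ^+ 3 / 27 = J ^+ 2 - s ^+ 2 by rewrite s2; ring.
    by rewrite b3; ring.
  by rewrite b3; ring.
- rewrite exprMn sqr_i -rmorphXn sqr_sqrtr ?ler0n // rmorph_nat; ring.
Qed.

Lemma alpha_sum i : al i + al (ordS i) + al (ordS (ordS i)) = 0.
Proof.
have [b [c [r [_ h0 h1 h2]]]] := cardanoE.
by move: i; apply: ord3P; rewrite !ordS3E h0 h1 h2; field.
Qed.

Lemma alpha_prod i : al (ordS i) * al (ordS (ordS i)) = al i ^+ 2 - I.
Proof.
have [b [c [r [[hI _ hr] h0 h1 h2]]]] := cardanoE.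
have {}hI : I = 3 * (b * c) by rewrite hI; field.
by move: i; apply: ord3P; rewrite !ordS3E h0 h1 h2 hI; field: hr.
Qed.

Lemma alpha_root i : is_root (al i).
Proof.
have [b [c [r [[hI hJ hr] h0 h1 h2]]]] := cardanoE.
have {}hI : I = 3 * (b * c) by rewrite hI; field.
rewrite /is_root -hJ hI.
by move: i; apply: ord3P; rewrite ?h0 ?h1 ?h2; field: hr.
Qed.

Lemma is_root_alpha (a : C) : is_root a -> exists i, a = al i.
Proof.
move=> ha.
have : (a - al 0) * ((a - al (ordS 0)) * (a - al (ordS (ordS 0)))) = 0.
  have /eqP := alpha_sum 0; rewrite -addrA addr_eq0 => /eqP h0.
  have h1 := alpha_prod 0; have h2 := alpha_root 0.
  set b := al 0 in h0 h1 h2 *.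
  set c := al _ in h0 h1 *; set d := al _ in h0 h1 *.
  have -> : (a - c) * (a - d) = a ^+ 2 + b * a + (b ^+ 2 - I).
    by rewrite -h1 h0; ring.
  transitivity (a ^+ 3 - I * a - (b ^+ 3 - I * b)); first by ring.
  by rewrite ha h2; ring.
move/eqP; rewrite !mulf_eq0 !subr_eq0 => /or3P[] /eqP; by eauto.
Qed.

(** Each of three distinct roots is some alpha_m; the resulting injective self-map of ['I_3] is
    bijective, which transfers distinctness to the alphas. *)
Lemma alpha_inj (x : 'I_3 -> C) :
  injective x -> (forall n, is_root (x n)) -> injective al.
Proof.
move=> xI xr.
have /fin_all_exists[f hf] n : exists m, x n = al m by exact: is_root_alpha.
have fI : injective f by move=> m n e; apply: xI; rewrite !hf e.
have [g fK gK] := injF_bij fI.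
by move=> m n; rewrite -[m]gK -[n]gK -!hf => /xI ->.
Qed.

(** * Oriented eigenframes in coordinates, for distinct roots *)

Section Distinct.
Hypothesis al_inj : injective al.

(** -2 D_i is the derivative of the characteristic polynomial at its root alpha_i, that is, the
    product of the differences with the other two roots. *)
Lemma coefD_neq0 i : coefD Psi (al i) != 0.
Proof.
have : (al i - al (ordS i)) * (al i - al (ordS (ordS i))) != 0.
  by rewrite mulf_neq0 // subr_eq0 eq_sym (inj_eq al_inj) ?ordS_neq ?ordSS_neq.
apply: contraNneq; rewrite /coefD => h.
have -> : (al i - al (ordS i)) * (al i - al (ordS (ordS i))) =
   al i ^+ 2 - al i * (al i + al (ordS i) + al (ordS (ordS i)) - al i)
     + al (ordS i) * al (ordS (ordS i)) by ring.
rewrite alpha_sum alpha_prod.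
have -> : al i ^+ 2 - al i * (0 - al i) + (al i ^+ 2 - I) =
    - 2 * (2^-1 * (I - 3 * al i ^+ 2)).
  by field.
by rewrite h mulr0.
Qed.

(* At most one [C_i] vanishes, since [C_i - C_j = Psi4 (alpha_i - alpha_j)]. *)
Lemma coefC_neq0 : exists i,
  coefC Psi (al (ordS i)) != 0 /\ coefC Psi (al (ordS (ordS i))) != 0.
Proof.
have [P40|P4n0] := eqVneq P4 0.
  (* If Psi3 = Psi4 = 0 the characteristic polynomial is (x - Psi2)^2 (x + 2 Psi2), and D vanishes
     at the double root. *)
  have P3n0 : P3 != 0.
    apply/eqP => P30.
    have [|i hi] := @is_root_alpha P2.
      by rewrite /is_root invJE /invI P40 P30; ring.
    have := coefD_neq0 i; rewrite -hi /coefD /invI P40 P30 => /eqP; apply.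
    ring.
  have h a : coefC Psi a != 0.
    have -> : coefC Psi a = - 2 * P3 ^+ 2 by rewrite /coefC P40; ring.
    by rewrite mulf_neq0 ?expf_neq0 // oppr_eq0 two_neq0.
  by exists 0.
have hC m n : m != n -> coefC Psi (al m) = 0 -> coefC Psi (al n) != 0.
  move=> mn h; apply: contra_neq mn => h'; apply: al_inj; apply: (mulfI P4n0).
  have e a : P4 * a = coefC Psi a - (2 * P2 * P4 - 2 * P3 ^+ 2).
    by rewrite /coefC; ring.
  by rewrite !e h h'.
have [h0|h0] := eqVneq (coefC Psi (al 0)) 0.
  by exists 0; split; apply: hC h0.
have [h1|h1] := eqVneq (coefC Psi (al 1)) 0.
  by exists 1; split; apply: hC h1.
by exists 2; rewrite !ordS3E.
Qed.

Definition frame3 (v : 'I_3 -> vec) :=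
  [/\ forall n, ip3 (v n) (v n) = -1,
      forall m n, m != n -> ip3 (v m) (v n) = 0
    & forall n, weyl3 (v n) = scale3 (al n) (v n)].

Definition cyclic3 (v : 'I_3 -> vec) :=
  forall n, v (ordS (ordS n)) = vee (v n) (v (ordS n)).

Lemma eigen_orthogonal m n x y :
  weyl3 x = scale3 (al m) x -> weyl3 y = scale3 (al n) y -> m != n ->
  ip3 x y = 0.
Proof.
move=> hx hy mn.
have := weyl3_sym x y; rewrite hx hy ip3Zl ip3Zr => /eqP.
rewrite -subr_eq0 -mulrBl mulf_eq0 subr_eq0 (inj_eq al_inj) (negPf mn) /=.
by move/eqP.
Qed.

Lemma vee_cyclic i v :
  ip3 (v (ordS i)) (v (ordS i)) = -1 ->
  ip3 (v (ordS (ordS i))) (v (ordS (ordS i))) = -1 ->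
  ip3 (v (ordS i)) (v (ordS (ordS i))) = 0 ->
  v i = vee (v (ordS i)) (v (ordS (ordS i))) -> cyclic3 v.
Proof.
move=> h1 h2 h12 h; apply: (@ord3_ind i); rewrite ?ordS3.
- rewrite h vee_veel h1 h12 /add3 /scale3 /=; case: (v _) => [[? ?] ?] /=.
  by do ![congr (_, _)]; ring.
- by [].
- rewrite h vee_veer h2 h12 /add3 /scale3 /=; case: (v (ordS i)) => [[? ?] ?] /=.
  by do ![congr (_, _)]; ring.
Qed.

(** By [weyl3_vee] the product of the two eigenvectors has eigenvalue minus the sum of theirs, which
    is alpha_i since the roots sum to zero. This reaches the index where (A, B, C) may vanish. *)
Lemma frame3_of_two i v :
  (forall n, n != i -> ip3 (v n) (v n) = -1) ->
  (forall n, n != i -> weyl3 (v n) = scale3 (al n) (v n)) ->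
  v i = vee (v (ordS i)) (v (ordS (ordS i))) -> frame3 v /\ cyclic3 v.
Proof.
move=> hu he hi.
have [u1 u2] := (hu _ (ordS_neq i), hu _ (ordSS_neq i)).
have [e1 e2] := (he _ (ordS_neq i), he _ (ordSS_neq i)).
have o12 : ip3 (v (ordS i)) (v (ordS (ordS i))) = 0.
  by apply: (eigen_orthogonal e1 e2); rewrite eq_sym ordS_neq.
have ei : weyl3 (v i) = scale3 (al i) (v i).
  rewrite hi weyl3_vee e1 e2.
  have -> : al i = - al (ordS i) - al (ordS (ordS i)).
    by rewrite -[LHS]subr0 -(alpha_sum i); ring.
  by rewrite /add3 /scale3 /vee /=; do ![congr (_, _)]; ring.
split; last exact: (vee_cyclic u1 u2 o12 hi).
have e n : weyl3 (v n) = scale3 (al n) (v n).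
  by have [->|/he] := eqVneq n i.
split=> //.
- move=> n; have [->|/hu //] := eqVneq n i.
  by rewrite hi ip3_vee u1 u2 o12; ring.
- by move=> m n mn; apply: (eigen_orthogonal (e m) (e n)).
Qed.

Lemma principal3_unit a r : is_root a -> coefD Psi a * coefC Psi a != 0 ->
  r ^+ 2 = coefD Psi a * coefC Psi a ->
  let u := scale3 r^-1 (principal3 a) in
  ip3 u u = -1 /\ weyl3 u = scale3 a u.
Proof.
move=> ha nz hr /=.
have rn0 : r != 0 by rewrite -sqrf_eq0 hr.
split.
  rewrite ip3Zl ip3Zr ip3_principal // -hr; field.
  by [].
have hw := weyl3_principal ha.
have -> : weyl3 (scale3 r^-1 (principal3 a)) =
    scale3 r^-1 (weyl3 (principal3 a)).
  by rewrite /weyl3 /scale3 /=; do ![congr (_, _)]; ring.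
by rewrite hw /scale3 /=; do ![congr (_, _)]; ring.
Qed.

(** The eigenvector (A, B, C) is orthogonal to the other two members of the frame, so it is a
    multiple r of [v n]; comparing norms identifies r as a square root of D C. *)
Lemma frame3_principal v n : frame3 v -> cyclic3 v ->
  coefD Psi (al n) * coefC Psi (al n) != 0 ->
  exists2 r, r ^+ 2 = coefD Psi (al n) * coefC Psi (al n)
    & v n = scale3 r^-1 (principal3 (al n)).
Proof.
move=> [vu vo ve] vc nz.
set q := principal3 _.
have qe : weyl3 q = scale3 (al n) q by apply/weyl3_principal/alpha_root.
have hq m : m != n -> ip3 q (v m) = 0.
  by move=> mn; apply: (eigen_orthogonal qe (ve m)); rewrite eq_sym.
have := ip3_expand q (v n) (v (ordS n)) (v (ordS (ordS n))).
have c1 := vc (ordS n); rewrite ordS3 in c1.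
have c2 := vc (ordS (ordS n)); rewrite !ordS3 in c2.
rewrite -c1 -c2 -vc vu (hq _ (ordS_neq n)) (hq _ (ordSS_neq n)) => hx.
pose r := - ip3 q (v n).
have qE : q = scale3 r (v n).
  move: hx; rewrite /add3 /scale3 /r; move: (ip3 q (v n)) => t /= [ha hb hc].
  rewrite /q /principal3; do ![congr (_, _)]; apply: oppr_inj.
  - by rewrite -mulN1r ha; ring.
  - by rewrite -mulN1r hb; ring.
  - by rewrite -mulN1r hc; ring.
have r2 : r ^+ 2 = coefD Psi (al n) * coefC Psi (al n).
  apply: oppr_inj; rewrite -ip3_principal; last exact: alpha_root.
  by rewrite -/q qE ip3Zl ip3Zr vu; ring.
exists r => //.
have rn0 : r != 0 by rewrite -sqrf_eq0 r2.
rewrite qE /scale3 /=; case: (v n) => [[a b] c] /=.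
by do ![congr (_, _)]; rewrite mulrA mulVf ?mul1r.
Qed.

End Distinct.
End Roots.
End Coordinates.

(** * 2-forms as matrices in a null frame *)

Section FrameMatrices.
Variables (K : fieldType) (s : K).
Local Notation vec := (K * K * K)%type.

Lemma mxtrace_congr n (B G x y : 'M[K]_n) :
  \tr (B^T *m x *m B *m G *m (B^T *m y *m B)^T *m G) =
  \tr (x *m (B *m G *m B^T) *m y^T *m (B *m G *m B^T)).
Proof. by rewrite !trmx_mul trmxK -!mulmxA mxtrace_mulC !mulmxA. Qed.

(** Inner products of the tetrad (l, k, m, conj m). The matrix is its own inverse, so it serves for
    both the metric and the inverse metric. *)
Definition gram : 'M[K]_4 :=
  \matrix_(a, b) nth 0 (nth [::] [:: [:: 0; -1; 0; 0]; [:: -1; 0; 0; 0];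
                                     [:: 0; 0; 0; 1]; [:: 0; 0; 1; 0]] a) b.

(* a U + b W + c V in the frame (l, k, m, conj m), with s = 1 / sqrt 2. *)
Definition comb_mx (v : vec) : 'M[K]_4 :=
  \matrix_(a, b) (s * nth 0 (nth [::]
    [:: [:: 0; v.1.2; 0; - v.1.1]; [:: - v.1.2; 0; v.2; 0];
        [:: 0; - v.2; 0; v.1.2]; [:: v.1.1; 0; - v.1.2; 0]] a) b).

(* The same for the complex conjugates of U, W, V. *)
Definition cobar_mx (v : vec) : 'M[K]_4 :=
  \matrix_(a, b) (s * nth 0 (nth [::]
    [:: [:: 0; v.1.2; - v.1.1; 0]; [:: - v.1.2; 0; 0; v.2];
        [:: v.1.1; 0; 0; - v.1.2]; [:: 0; - v.2; v.1.2; 0]] a) b).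

Ltac mx4 :=
  apply/matrixP; case=> [[|[|[|[|?]]]] ?] //; case=> [[|[|[|[|?]]]] ?] //;
  rewrite !(mxE, big_ord_recl, big_ord0) /=.

Lemma gramK : gram *m gram = 1%:M.
Proof. by mx4; ring. Qed.

Lemma eq_gram (A : 'M[K]_4) : A^T = A ->
  [/\ A 0 0 = 0, A 1 1 = 0, A 2 2 = 0 & A 3 3 = 0] ->
  [/\ A 0 1 = -1, A 0 2 = 0 & A 0 3 = 0] ->
  [/\ A 1 2 = 0, A 1 3 = 0 & A 2 3 = 1] -> A = gram.
Proof.
move=> sA.
pose e a b := A (inord a) (inord b).
have AE a b : A a b = e a b by rewrite /e !inord_val.
have eC a b : e a b = e b a by rewrite /e -[A in LHS]sA mxE.
rewrite !AE => -[e00 e11 e22 e33] [e01 e02 e03] [e12 e13 e23].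
apply/matrixP; case=> [[|[|[|[|?]]]] ?] //; case=> [[|[|[|[|?]]]] ?] //.
all: by rewrite AE mxE //= eC.
Qed.

Lemma comb_mx_anti v : (comb_mx v)^T = - comb_mx v.
Proof. by mx4; ring. Qed.

Lemma gram_norm (q : 'rV[K]_4) :
  (q *m gram *m q^T) 0 0 = 2 * (q 0 2 * q 0 3 - q 0 0 * q 0 1).
Proof.
pose e a := q 0 (inord a).
have -> : q = \row_a e a by apply/rowP => a; rewrite mxE /e inord_val.
by rewrite !(mxE, big_ord_recl, big_ord0) /=; ring.
Qed.

Lemma alt_rowsE n (A B : 'rV[K]_n) a b :
  (A^T *m B - B^T *m A) a b = A 0 a * B 0 b - B 0 a * A 0 b.
Proof. by rewrite !mxE !big_ord1 !mxE. Qed.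

Lemma comb_entry n a b c (x y z t : 'M[K]_n) e f :
  (a *: (- s *: x) + b *: (s *: (y + z)) + c *: (s *: t)) e f =
  s * (- a * x e f + b * (y e f + z e f) + c * t e f).
Proof. by rewrite !mxE; ring. Qed.

Lemma mulmx4E (A B : 'M[K]_4) a b :
  (A *m B) a b = A a 0 * B 0 b + A a 1 * B 1 b + A a 2 * B 2 b + A a 3 * B 3 b.
Proof.
rewrite mxE !big_ord_recl big_ord0 addr0 !addrA.
by congr (_ * _ + _ * _ + _ * _ + _ * _); congr (_ _ _); apply/val_inj.
Qed.

Lemma gram_mulE (A : 'M[K]_4) a b :
  (gram *m A) a b = nth 0 [:: - A 1 b; - A 0 b; A 3 b; A 2 b] a.
Proof.
rewrite mulmx4E !mxE; case: a => [[|[|[|[|?]]]] ?] //=.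
all: by rewrite ?(mul0r, add0r, addr0, mulN1r, mul1r).
Qed.

(** Self-dual 2-forms multiply like quaternions: the antisymmetric part of the product is again a
    self-dual 2-form, and the symmetric part is a multiple of the metric. *)
Lemma comb_mx_cross (j t : K) v w : s ^+ 2 = 2^-1 -> t = 2 * s -> 2 != 0 :> K ->
  (j * t) *: (comb_mx v *m gram *m comb_mx w) =
  comb_mx (j * (v.1.1 * w.1.2 - v.1.2 * w.1.1),
           j / 2 * (v.1.1 * w.2 - v.2 * w.1.1),
           j * (v.1.2 * w.2 - v.2 * w.1.2))
  - (j * s * (2^-1 * (v.1.1 * w.2 + v.2 * w.1.1) - v.1.2 * w.1.2)) *: gram.
Proof.
move=> s2 -> two0.
have {}s2 : 2 * s ^+ 2 = 1 by rewrite s2 mulfV.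
case: v w => [[a b] c] [[a' b'] c'].
(* The left side has degree 3 in [s] and the right side degree 1; 2 s^2 = 1 bridges the gap. *)
have h x y : x = (2 * s ^+ 2) * y -> x = y by rewrite s2 mul1r.
apply/matrixP; case=> [[|[|[|[|?]]]] ?] //; case=> [[|[|[|[|?]]]] ?] //.
all: rewrite [LHS]mxE -mulmxA mulmx4E !gram_mulE !mxE /=.
all: rewrite ?(mulr0, mul0r, addr0, add0r, oppr0, subr0) //.
all: by apply: h; field.
Qed.

Lemma comb_mx_ip v w : s ^+ 2 = 2^-1 -> 2 != 0 :> K ->
  \tr (comb_mx v *m gram *m (comb_mx w)^T *m gram) =
  2 * (2^-1 * (v.1.1 * w.2 + v.2 * w.1.1) - v.1.2 * w.1.2).
Proof.
move=> s2 two0.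
have {}s2 : 2 * s ^+ 2 = 1 by rewrite s2 mulfV.
have h x y : x = (2 * s ^+ 2) * y -> x = y by rewrite s2 mul1r.
case: v w => [[a b] c] [[a' b'] c'].
have -> : \tr (comb_mx (a, b, c) *m gram *m (comb_mx (a', b', c'))^T *m gram) =
  - \tr ((gram *m comb_mx (a, b, c)) *m (gram *m comb_mx (a', b', c'))).
  rewrite comb_mx_anti mulmxN mulNmx linearN; congr (- _).
  by rewrite [LHS]mxtrace_mulC !mulmxA.
move: (gram *m _) (gram_mulE (comb_mx (a, b, c))) => X hX.
move: (gram *m _) (gram_mulE (comb_mx (a', b', c'))) => Y hY.
rewrite /mxtrace !big_ord_recl big_ord0 !mulmx4E !hX !hY !mxE /=.
rewrite ?(mulr0, mul0r, addr0, add0r, oppr0, subr0).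
by apply: h; field.
Qed.

Lemma anti_mx_comb (x : 'M[K]_4) : s != 0 -> 2 != 0 :> K -> x^T = - x ->
  exists v w, x = comb_mx v + cobar_mx w.
Proof.
move=> s0 two0 xT.
pose e a b := x (inord a) (inord b).
have xE : x = \matrix_(a, b) e a b.
  by apply/matrixP => a b; rewrite mxE /e !inord_val.
have anti a b : e b a = - e a b by rewrite /e -[x in LHS]trmxK mxE xT !mxE.
have diag a : e a a = 0.
  apply/eqP; have /eqP := anti a a.
  by rewrite -addr_eq0 -mulr2n -mulr_natl mulf_eq0 (negPf two0).
(* Entries (0,3) and (1,2) involve only [comb_mx], entries (0,2) and (1,3) only [cobar_mx]; (0,1)
   and (2,3) carry the sum and the difference of the middle coordinates. *)
exists (- e 0%N 3 / s, (e 0%N 1 + e 2 3) / (2 * s), e 1 2 / s)%N.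
exists (- e 0%N 2 / s, (e 0%N 1 - e 2 3) / (2 * s), e 1 3 / s)%N.
rewrite xE; mx4; rewrite ?diag.
all: rewrite ?(anti 0%N 1%N, anti 0%N 2, anti 0%N 3).
all: rewrite ?(anti 1%N 2, anti 1%N 3, anti 2 3).
all: by field; rewrite ?s0 ?two0.
Qed.

Definition alt_mx a b : 'M[K]_4 := delta_mx a b - delta_mx b a.

Lemma comb_mxE v (o : nat -> 'I_4) : (forall n, (n < 4)%N -> o n = n :> nat) ->
  comb_mx v =
   v.1.1 *: (- s *: alt_mx (o 0) (o 3))
  + v.1.2 *: (s *: (alt_mx (o 0) (o 1) +
     alt_mx (o 2) (o 3)))
  + v.2 *: (s *: alt_mx (o 1) (o 2)).
Proof.
move=> h.
apply/matrixP => a b; rewrite /alt_mx !mxE -!val_eqE /= !h //.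
by case: a => -[|[|[|[|]]]] ? //; case: b => -[|[|[|[|]]]] ? //=; ring.
Qed.

Lemma cobar_mxE v (o : nat -> 'I_4) : (forall n, (n < 4)%N -> o n = n :> nat) ->
  cobar_mx v =
   v.1.1 *: (- s *: alt_mx (o 0) (o 2))
  + v.1.2 *: (s *: (alt_mx (o 0) (o 1) +
     alt_mx (o 3) (o 2)))
  + v.2 *: (s *: alt_mx (o 1) (o 3)).
Proof.
move=> h.
apply/matrixP => a b; rewrite /alt_mx !mxE -!val_eqE /= !h //.
by case: a => -[|[|[|[|]]]] ? //; case: b => -[|[|[|[|]]]] ? //=; ring.
Qed.

End FrameMatrices.

(** * Null tetrads *)

Section Tetrad.
Variables (R : rcfType) (p : spacetime_point R).
Local Notation C := R[i].
Local Notation vec := (C * C * C)%type.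
Local Notation g := (toC (metric p)).
Local Notation ginv := (toC (invmx (metric p))).
Local Notation "x ^cj" := (conjc x) (at level 2, format "x ^cj").
Local Notation conjm := (map_mx conjc).

Lemma metric_sym : (metric p)^T = metric p.
Proof.
have [P _ ->] := metric_signature p.
by rewrite !trmx_mul trmxK mulmxA /minkowski tr_diag_mx.
Qed.

Lemma metric_unit : metric p \in unitmx.
Proof.
have [P uP ->] := metric_signature p.
rewrite !unitmx_mul unitmx_tr uP andbT /= unitmxE det_diag.
rewrite unitfE; apply/prodf_neq0 => i _; rewrite mxE.
by case: ifP; rewrite ?oppr_eq0 oner_neq0.
Qed.

Lemma g_sym : g^T = g.
Proof. by rewrite /toC map_trmx metric_sym. Qed.

Lemma mul_g_ginv : g *m ginv = 1%:M.
Proof. by rewrite /toC -map_mxM mulmxV ?metric_unit // map_mx1. Qed.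

Lemma mul_ginv_g : ginv *m g = 1%:M.
Proof. by rewrite /toC -map_mxM mulVmx ?metric_unit // map_mx1. Qed.

Lemma ginv_sym : ginv^T = ginv.
Proof.
by rewrite /toC map_trmx trmx_inv metric_sym.
Qed.

Lemma dotC u v : dot p u v = dot p v u.
Proof.
transitivity ((u *m g *m v^T)^T 0 0); first by rewrite [RHS]mxE.
by rewrite !trmx_mul trmxK g_sym mulmxA.
Qed.

Lemma conj_toC m n (A : 'M[R]_(m, n)) : conjm (toC A) = toC A.
Proof. by apply/matrixP => a b; rewrite !mxE conjc_real. Qed.

Lemma conjmK m n : cancel (conjm : 'M[C]_(m, n) -> 'M[C]_(m, n)) conjm.
Proof. by move=> A; apply/matrixP => a b; rewrite !mxE conjcK. Qed.

Lemma dot_conj u v : dot p (conjm u) (conjm v) = (dot p u v)^cj.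
Proof.
transitivity ((conjm (u *m g *m v^T)) 0 0); last by rewrite mxE.
by rewrite /dot !map_mxM /= conj_toC map_trmx.
Qed.

Lemma conj_wedge u v : conjm (wedge p u v) = wedge p (conjm u) (conjm v).
Proof.
by rewrite /wedge map_mxB !map_mxM -!map_trmx !map_mxM /= conj_toC.
Qed.

Lemma ipE X Y : ip p X Y = 2^-1 * \tr (X *m ginv *m Y^T *m ginv).
Proof.
congr (_ * _); rewrite -!mulmxA.
have -> : ginv *m (Y^T *m ginv) = (raise p Y)^T.
  by rewrite /raise !trmx_mul trmxK ginv_sym.
rewrite /mxtrace; apply: eq_bigr => a _; rewrite mxE.
by apply: eq_bigr => b _; rewrite !mxE.
Qed.

Lemma ipC X Y : ip p X Y = ip p Y X.
Proof.
rewrite !ipE -mxtrace_tr !trmx_mul trmxK ginv_sym mxtrace_mulC.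
by rewrite !mulmxA.
Qed.

Lemma ipPr a X Y Z : ip p X (a *: Y + Z) = a * ip p X Y + ip p X Z.
Proof.
rewrite !ipE linearP mulmxDr mulmxDl mxtraceD -scalemxAr -scalemxAl mxtraceZ.
by rewrite mulrDr mulrCA.
Qed.

Lemma ipDl X Y Z : ip p (X + Y) Z = ip p X Z + ip p Y Z.
Proof. by rewrite !(ipC _ Z) -{1}[X]scale1r ipPr mul1r. Qed.

Lemma ip0l X : ip p 0 X = 0.
Proof. by rewrite ipE !mul0mx mxtrace0 mulr0. Qed.

Lemma ipZl a X Y : ip p (a *: X) Y = a * ip p X Y.
Proof. by rewrite !(ipC _ Y) -[a *: X]addr0 ipPr !(ipC Y) ip0l addr0. Qed.

Lemma hodgeP a X Y : hodge p (a *: X + Y) = a *: hodge p X + hodge p Y.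
Proof.
apply/matrixP => e f; rewrite !mxE mulrCA -mulrDr; congr (_ * _).
rewrite mulr_sumr -big_split; apply: eq_bigr => c _ /=.
rewrite mulr_sumr -big_split; apply: eq_bigr => d _ /=.
have -> : raise p (a *: X + Y) = a *: raise p X + raise p Y.
  by rewrite /raise mulmxDr mulmxDl -scalemxAr -scalemxAl.
by rewrite !mxE; ring.
Qed.

Lemma hodge_conj X : hodge p (conjm X) = conjm (hodge p X).
Proof.
apply/matrixP => e f; rewrite !mxE rmorphM fmorphV rmorph_nat; congr (_ * _).
rewrite rmorph_sum; apply: eq_bigr => c _.
rewrite rmorph_sum; apply: eq_bigr => d _.
rewrite rmorphM; congr (_ * _); first exact/esym/conjc_real.
have -> : raise p (conjm X) = conjm (raise p X).
  by rewrite /raise !map_mxM -map_trmx /= conj_toC.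
by rewrite mxE.
Qed.

Lemma conjcM (a b : C) : (a * b)^cj = a^cj * b^cj.
Proof. exact: rmorphM. Qed.

Lemma conjcN (a : C) : (- a)^cj = - a^cj.
Proof. exact: rmorphN. Qed.

Lemma dotP a u v w : dot p (a *: u + v) w = a * dot p u w + dot p v w.
Proof.
by rewrite /dot !mulmxDl -!scalemxAl [LHS]mxE [X in X + _ = _]mxE.
Qed.

(** Time orientation is moved to the order of [R[i]], where the tetrad products with complex [m] can
    take part in the estimate. *)
Lemma future_dot u : (u *m metric p *m (future p)^T) 0 0 < 0 =
  (dot p (toC u) (toC (future p)) < 0).
Proof.
have -> : dot p (toC u) (toC (future p)) =
    ((u *m metric p *m (future p)^T) 0 0)%:C.
  by rewrite /dot /toC map_trmx -!map_mxM mxE.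
by rewrite -(ltcR _ 0).
Qed.

Lemma real_vec (v : 'rV[C]_4) : conjm v = v -> exists u, v = toC u.
Proof.
move=> h; exists (map_mx (@complex.Re R) v); apply/rowP => a; rewrite !mxE.
have : (v 0 a)^cj = v 0 a by rewrite -[in RHS]h mxE.
case: (v 0 a) => x y /= [] /eqP.
by rewrite eq_sym -addr_eq0 -mulr2n mulrn_eq0 /= => /eqP ->.
Qed.

(** * The bivector base of a fixed null tetrad *)

Section NullBase.
Variables (l k m m' : 'rV[C]_4) (W U V : 'M[C]_4).
Hypotheses (lR : conjm l = l) (kR : conjm k = k) (mR : conjm m = m').
Hypothesis dots_null : [/\ dot p l l = 0, dot p k k = 0 & dot p m m = 0].
Hypothesis dots_unit : dot p l k = -1 /\ dot p m m' = 1.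
Hypothesis dots_orth : dot p l m = 0 /\ dot p k m = 0.
Local Notation s := ((Num.sqrt (2 : R))^-1%:C).
Hypothesis WE : W = s *: (wedge p l k + wedge p m m').
Hypothesis UE : U = - s *: wedge p l m'.
Hypothesis VE : V = s *: wedge p k m.

Lemma s2 : s ^+ 2 = 2^-1.
Proof.
rewrite -rmorphXn /= exprVn sqr_sqrtr ?ler0n // fmorphV rmorph_nat //.
Qed.

Definition legs : 'I_4 -> 'rV[C]_4 := fun a => nth 0 [:: l; k; m; m'] a.

Definition coframe : 'M[C]_4 := \matrix_a (legs a *m g).

Local Notation gram := (gram C).

Definition comb (v : vec) : 'M[C]_4 := v.1.1 *: U + v.1.2 *: W + v.2 *: V.

Lemma coframe_gram : coframe *m ginv *m coframe^T = gram.
Proof.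
have h a b : (coframe *m ginv *m coframe^T) a b = dot p (legs a) (legs b).
  have -> : (coframe *m ginv *m coframe^T) a b =
    (row a coframe *m ginv *m (row b coframe)^T) 0 0.
    by rewrite -!row_mul !mxE; apply: eq_bigr => c _; rewrite !mxE.
  by rewrite !rowK trmx_mul g_sym mulmxA -(mulmxA _ ginv) mul_ginv_g mulmx1.
have [[ll kk mm] [lk mm'] [lm km]] := And3 dots_null dots_unit dots_orth.
have lm' : dot p l m' = 0 by rewrite -lR -mR dot_conj lm rmorph0.
have km' : dot p k m' = 0 by rewrite -kR -mR dot_conj km rmorph0.
have m'm' : dot p m' m' = 0 by rewrite -mR dot_conj mm rmorph0.
apply: eq_gram; first by rewrite !trmx_mul trmxK ginv_sym mulmxA.
- by split; rewrite h.
- by split; rewrite h.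
- by split; rewrite h.
Qed.

Lemma coframe_unit : coframe \in unitmx.
Proof.
have : gram \in unitmx by apply: (proj1 (mulmx1_unit (gramK C))).
by rewrite -coframe_gram !unitmx_mul => /andP[/andP[]].
Qed.

Lemma coframe_g : coframe^T *m gram *m coframe = g.
Proof.
have : coframe *m (ginv *m coframe^T *m gram) = 1%:M.
  by rewrite !mulmxA coframe_gram gramK.
move/mulmx1C => h.
transitivity (g *m (ginv *m coframe^T *m gram *m coframe)).
  by rewrite !mulmxA mul_g_ginv mul1mx.
by rewrite h mulmx1.
Qed.

Definition pull (x : 'M[C]_4) : 'M[C]_4 := coframe^T *m x *m coframe.

Lemma pullD x y : pull (x + y) = pull x + pull y.
Proof. by rewrite /pull mulmxDr mulmxDl. Qed.

Lemma pullZ a x : pull (a *: x) = a *: pull x.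
Proof. by rewrite /pull -scalemxAr -scalemxAl. Qed.

Lemma wedge_legs a b : wedge p (legs a) (legs b) =
  pull (alt_mx C a b).
Proof.
have h (c d : 'I_4) : (legs c *m g)^T *m (legs d *m g) = pull (delta_mx c d).
  have rowE' e : legs e *m g = delta_mx 0 e *m coframe by rewrite -rowE rowK.
  rewrite !rowE' trmx_mul trmx_delta -!mulmxA (mulmxA (delta_mx c _)).
  by rewrite mul_delta_mx /pull mulmxA.
by rewrite /wedge /alt_mx !h -[in RHS]scaleN1r pullD pullZ scaleN1r.
Qed.

Let o n : 'I_4 := inord n.

Let oE n : (n < 4)%N -> o n = n :> nat.
Proof. by move=> h; rewrite inordK. Qed.

Lemma pull_comb a b c d x y z t :
  pull (a *: (- d *: x) + b *: (d *: (y + z)) + c *: (d *: t)) =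
  a *: (- d *: pull x) + b *: (d *: (pull y + pull z)) + c *: (d *: pull t).
Proof. by rewrite !pullD !pullZ pullD. Qed.

Lemma combE v : comb v = pull (comb_mx s v).
Proof.
have -> := comb_mxE s v oE.
rewrite pull_comb -!wedge_legs /legs !oE // /comb UE WE VE; reflexivity.
Qed.

Lemma cobarE v : v.1.1 *: conjm U + v.1.2 *: conjm W + v.2 *: conjm V =
  pull (cobar_mx s v).
Proof.
have -> := cobar_mxE s v oE.
have hZ X : conjm (s *: X) = s *: conjm X.
  by rewrite map_mxZ; congr (_ *: _); apply: conjc_real.
have m'R : conjm m' = m by rewrite -mR conjmK.
have -> : conjm U = - s *: wedge p l m.
  rewrite UE !scaleNr map_mxN hZ conj_wedge lR m'R; reflexivity.
have -> : conjm V = s *: wedge p k m'.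
  rewrite VE hZ conj_wedge kR mR; reflexivity.
have -> : conjm W = s *: (wedge p l k + wedge p m' m).
  rewrite WE hZ map_mxD !conj_wedge lR kR mR m'R; reflexivity.
rewrite pull_comb -!wedge_legs /legs !oE //; reflexivity.
Qed.

Lemma i_neq0 : 'i != 0 :> C.
Proof. by rewrite -sqrf_eq0 sqr_i oppr_eq0 oner_eq0. Qed.

Lemma comb_scale a v : comb (scale3 a v) = a *: comb v.
Proof. by rewrite /comb /scale3 /= !scalerDr !scalerA; reflexivity. Qed.

Lemma comb_add v w : comb (add3 v w) = comb v + comb w.
Proof. by apply/matrixP => a b; rewrite /comb !mxE /=; ring. Qed.

Lemma cross_pull x y : cross p (pull x) (pull y) = pull (x *m gram *m y).
Proof. rewrite /cross /pull -coframe_gram !mulmxA; reflexivity. Qed.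

Lemma two_s : (Num.sqrt (2 : R))%:C = 2 * s.
Proof.
rewrite -[2 in RHS](rmorph_nat (real_complex R)) -rmorphM; congr (_%:C).
have nz : Num.sqrt (2 : R) != 0 by rewrite sqrtr_eq0 -ltNge ltr0n.
by apply: (mulIf nz); rewrite mulfVK // -expr2 sqr_sqrtr ?ler0n.
Qed.

Lemma pullBZ x a y : pull (x - a *: y) = pull x - a *: pull y.
Proof. by rewrite -scaleNr pullD pullZ scaleNr. Qed.

Lemma cross_comb v w : ('i * (Num.sqrt 2)%:C) *: cross p (comb v) (comb w) =
  comb (vee 'i v w) - ('i * s * ip3 v w) *: g.
Proof.
rewrite !combE cross_pull -pullZ.
have -> := comb_mx_cross 'i v w s2 two_s (two_neq0 R).
rewrite pullBZ.
have -> : pull gram = g by exact: coframe_g.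
reflexivity.
Qed.

Lemma ip_comb v w : ip p (comb v) (comb w) = ip3 v w.
Proof.
rewrite ipE !combE.
have -> := mxtrace_congr coframe ginv (comb_mx s v) (comb_mx s w).
rewrite coframe_gram.
have -> := comb_mx_ip v w s2 (two_neq0 R).
by rewrite mulrA mulVf ?two_neq0 // mul1r.
Qed.

Lemma comb_inj : injective comb.
Proof.
move=> v w e.
have h z : ip3 v z = ip3 w z by rewrite -!ip_comb e.
have := h (1, 0, 0); have := h (0, 1, 0); have := h (0, 0, 1).
rewrite /ip3 /= !(mulr0, mulr1, add0r, addr0, subr0, sub0r).
have i2 : (2 : C)^-1 != 0 by rewrite invr_eq0 two_neq0.
move=> /(mulfI i2) h1 /oppr_inj h2 /(mulfI i2) h3.
by move: h1 h2 h3; case: v w {h e} => [[? ?] ?] [[? ?] ?] /= -> -> ->.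
Qed.

Hypotheses (sdW : self_dual p W) (sdU : self_dual p U) (sdV : self_dual p V).

Lemma self_dual_comb v : self_dual p (comb v).
Proof.
have [[W1 W2] [U1 U2] [V1 V2]] := And3 sdW sdU sdV.
split.
  by rewrite combE /pull !trmx_mul trmxK comb_mx_anti mulNmx mulmxN mulmxA.
rewrite /comb -addrA !hodgeP -[v.2 *: V]addr0 hodgeP W2 U2 V2.
have -> : hodge p 0 = 0.
  by have := hodgeP (-1) 0 0; rewrite scaler0 addr0 scaleN1r addNr.
rewrite !addr0 !scalerDr !scalerA ![_ * 'i]mulrC; reflexivity.
Qed.

Lemma hodge_conj_comb v : hodge p (conjm (comb v)) = - 'i *: conjm (comb v).
Proof.
have [_ h] := self_dual_comb v.
rewrite hodge_conj h map_mxZ; congr (_ *: _).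
by apply/eqP; rewrite eq_complex /= oppr0 !eqxx.
Qed.

Lemma cobar_conj w : pull (cobar_mx s w) =
  conjm (comb (w.1.1^cj, w.1.2^cj, w.2^cj)).
Proof.
rewrite -cobarE /comb !map_mxD !map_mxZ /=.
by rewrite !conjcK.
Qed.

(* As [hodge] is real, the conjugates of U, W, V are anti-self-dual; together with
   U, W, V they span the 2-forms. *)
Lemma self_dual_span X : self_dual p X -> exists v, X = comb v.
Proof.
move=> [XT hX].
have [B uB BE] : exists2 B, B \in unitmx & coframe = B.
  by exists coframe; rewrite ?coframe_unit.
pose x := (invmx B)^T *m X *m invmx B.
have xT : x^T = - x by rewrite /x !trmx_mul trmxK XT mulNmx mulmxN mulmxA.
have s0 : s != 0.
  by rewrite -sqrf_eq0 s2 invr_eq0 two_neq0.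
have [v [w xE]] := anti_mx_comb s0 (two_neq0 R) xT.
have XE : X = comb v + conjm (comb (w.1.1^cj, w.1.2^cj, w.2^cj)).
  rewrite -cobar_conj combE -pullD -xE /x /pull BE !mulmxA -trmx_mul mulVmx //.
  by rewrite trmx1 mul1mx -mulmxA mulVmx // mulmx1.
exists v; rewrite XE.
suff -> : conjm (comb (w.1.1^cj, w.1.2^cj, w.2^cj)) = 0 by rewrite addr0.
set Y := conjm _ in XE *.
have hY : hodge p Y = - 'i *: Y by exact: hodge_conj_comb.
have [_ hv] := self_dual_comb v.
have : hodge p X = 'i *: comb v - 'i *: Y.
  by rewrite XE -[comb v]scale1r hodgeP hv hY !scale1r scaleNr.
rewrite hX XE scalerDr => /addrI /eqP.
rewrite -addr_eq0 -scalerDl scaler_eq0 => /orP[|/eqP //].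
by rewrite -mulr2n -mulr_natl mulf_eq0 (negPf (two_neq0 R)) (negPf i_neq0).
Qed.

(** The trailing 0 gives every partial sum the shape [a *: u + v] required by [dotP]. *)
Definition lin4 a b c d : 'rV[C]_4 :=
  a *: l + (b *: k + (c *: m + (d *: m' + 0))).

Lemma dot_lin4 a b c d u : dot p (lin4 a b c d) u =
  a * dot p l u + b * dot p k u + c * dot p m u + d * dot p m' u.
Proof.
rewrite /lin4 !dotP.
have -> : dot p 0 u = 0 by rewrite /dot !mul0mx mxE.
by rewrite addr0 !addrA.
Qed.

Lemma dot_lin4_lin4 a b c d a' b' c' d' :
  dot p (lin4 a b c d) (lin4 a' b' c' d') = - a * b' - b * a' + c * d' + d * c'.
Proof.
rewrite dot_lin4 !(dotC _ (lin4 _ _ _ _)) !dot_lin4.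
have [[ll kk mm] [lk mm'] [lm km]] := And3 dots_null dots_unit dots_orth.
have lm' : dot p l m' = 0 by rewrite -lR -mR dot_conj lm rmorph0.
have km' : dot p k m' = 0 by rewrite -kR -mR dot_conj km rmorph0.
have m'm' : dot p m' m' = 0 by rewrite -mR dot_conj mm rmorph0.
rewrite !(dotC k l, dotC m l, dotC m' l, dotC m k, dotC m' k, dotC m' m).
rewrite ll kk mm lk mm' lm km lm' km' m'm'; ring.
Qed.

Lemma conj_lin4 a b c d : conjm (lin4 a b c d) = lin4 a^cj b^cj d^cj c^cj.
Proof.
have m'R : conjm m' = m by rewrite -mR conjmK.
rewrite /lin4 !map_mxD !map_mxZ lR kR mR m'R map_mx0 !addr0.
congr (_ + (_ + _)); exact: addrC.
Qed.

(** Completeness of the tetrad. Applied to [future p], it turns timelikeness into a reversed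
    Cauchy-Schwarz inequality between the tetrad products. *)
Lemma dot_self u : dot p u u =
  2 * (dot p m u * dot p m' u - dot p l u * dot p k u).
Proof.
have -> : dot p u u = (u *m coframe^T *m gram *m (u *m coframe^T)^T) 0 0.
  by rewrite /dot -coframe_g !trmx_mul trmxK !mulmxA.
have h a : (u *m coframe^T) 0 a = dot p (legs a) u.
  rewrite dotC /dot -mulmxA -[g in RHS]g_sym -trmx_mul !mxE.
  by apply: eq_bigr => b _; rewrite !mxE.
have -> := gram_norm (u *m coframe^T).
by rewrite !h.
Qed.

Definition low (u : 'rV[C]_4) (a : 'I_4) : C := (u *m g) 0 a.

Lemma wedgeE u v a b : wedge p u v a b = low u a * low v b - low v a * low u b.
Proof. exact: alt_rowsE. Qed.

Lemma low_lin4 a b c d e : low (lin4 a b c d) e =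
  a * low l e + b * low k e + c * low m e + d * low m' e.
Proof.
rewrite /low /lin4 !mulmxDl -!scalemxAl mul0mx.
rewrite addr0 !addrA.
do 3![rewrite [LHS]mxE; congr (_ + _); last by rewrite mxE].
by rewrite mxE.
Qed.

Lemma wedge_lin4 a b c d a' b' c' d' e f :
  wedge p (lin4 a b c d) (lin4 a' b' c' d') e f =
  (a * low l e + b * low k e + c * low m e + d * low m' e)
    * (a' * low l f + b' * low k f + c' * low m f + d' * low m' f)
  - (a' * low l e + b' * low k e + c' * low m e + d' * low m' e)
    * (a * low l f + b * low k f + c * low m f + d * low m' f).
Proof.
apply: etrans (wedgeE _ _ _ _) _.
by congr (_ * _ - _ * _); apply: low_lin4.
Qed.

(* With a spinor frame (o, h) such that l = o o*, k = h h*, m = - h o*, the tetrad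
   (l2, k2, m2) is the one of the frame (x o + y h, z o + t h). *)
Section Spinor.
Variables x y z t : C.
Hypothesis det1 : x * t - y * z = 1.

Let l2 := lin4 (x * x^cj) (y * y^cj) (- (x^cj * y)) (- (x * y^cj)).
Let k2 := lin4 (z * z^cj) (t * t^cj) (- (z^cj * t)) (- (z * t^cj)).
Let m2 := lin4 (- (z * x^cj)) (- (t * y^cj)) (t * x^cj) (z * y^cj).
Let m2' := lin4 (- (z^cj * x)) (- (t^cj * y)) (z^cj * y) (t^cj * x).

Lemma spin_reality : [/\ conjm l2 = l2, conjm k2 = k2 & conjm m2 = m2'].
Proof.
split; apply: etrans (conj_lin4 _ _ _ _) _; rewrite !(conjcN, conjcM, conjcK);
  congr (lin4 _ _ _ _); ring.
Qed.

Lemma det1C : x^cj * t^cj = 1 + y^cj * z^cj.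
Proof.
by rewrite -(conjcM y z) -conjc1 -(rmorphD conjc) /= -det1 subrK conjcM.
Qed.

Lemma spin_dots :
  [/\ dot p l2 l2 = 0, dot p k2 k2 = 0 & dot p m2 m2 = 0] /\
  (dot p l2 k2 = -1 /\ dot p m2 m2' = 1) /\
  (dot p l2 m2 = 0 /\ dot p k2 m2 = 0).
Proof.
(* The nonzero products of the new tetrad are, up to sign, the squared modulus of the
   determinant. *)
have h : (x * t - y * z) * (x^cj * t^cj - y^cj * z^cj) = 1.
  by rewrite det1 det1C addrK mulr1.
have hN := congr1 -%R h.
split; last split; split; apply: etrans (dot_lin4_lin4 _ _ _ _ _ _ _ _) _;
  first [ring | rewrite -h; ring | rewrite -hN; ring].
Qed.

Lemma comb_spin_entry a b c e f : comb (a, b, c) e f =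
  s * (- a * (low l e * low m' f - low m' e * low l f)
       + b * ((low l e * low k f - low k e * low l f)
              + (low m e * low m' f - low m' e * low m f))
       + c * (low k e * low m f - low m e * low k f)).
Proof.
rewrite /comb WE UE VE; apply: etrans (comb_entry _ _ _ _ _ _ _ _ _ _) _.
by congr (_ * (_ * _ + _ * (_ + _) + _ * _)); apply: wedgeE.
Qed.

(** Up to the factor [s] and the conjugate area form of the spinor plane, U, W, V are the symmetric
    products o o, o h + h o, h h. Replacing o by x o + y h and h by z o + t h gives the coordinates
    here and in [spin_V], [spin_W]; the area form contributes the conjugate determinant, whence
    [det1C]. *)
Lemma spin_U : comb (x ^+ 2, x * y, y ^+ 2) = - s *: wedge p l2 m2'.
Proof.
apply/matrixP => a b; rewrite comb_spin_entry.
have -> : (- s *: wedge p l2 m2') a b = - s * wedge p l2 m2' a b.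
  by rewrite [LHS]mxE.
have e1 : wedge p l2 m2' a b = _ := wedge_lin4 _ _ _ _ _ _ _ _ a b.
rewrite {}e1.
have := det1C.
move: s (x^cj) (y^cj) (z^cj) (t^cj) (low l a) (low l b) (low k a) (low k b)
  (low m a) (low m b) (low m' a) (low m' b) => ? ? ? ? ? ? ? ? ? ? ? ? ? h.
ring: h.
Qed.

Lemma spin_V : comb (z ^+ 2, z * t, t ^+ 2) = s *: wedge p k2 m2.
Proof.
apply/matrixP => a b; rewrite comb_spin_entry.
have -> : (s *: wedge p k2 m2) a b = s * wedge p k2 m2 a b.
  by rewrite [LHS]mxE.
have e1 : wedge p k2 m2 a b = _ := wedge_lin4 _ _ _ _ _ _ _ _ a b.
rewrite {}e1.
have := det1C.
move: s (x^cj) (y^cj) (z^cj) (t^cj) (low l a) (low l b) (low k a) (low k b)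
  (low m a) (low m b) (low m' a) (low m' b) => ? ? ? ? ? ? ? ? ? ? ? ? ? h.
ring: h.
Qed.

Lemma spin_W : comb (2 * (x * z), x * t + y * z, 2 * (y * t)) =
  s *: (wedge p l2 k2 + wedge p m2 m2').
Proof.
apply/matrixP => a b; rewrite comb_spin_entry.
have -> : (s *: (wedge p l2 k2 + wedge p m2 m2')) a b =
    s * (wedge p l2 k2 a b + wedge p m2 m2' a b).
  by rewrite [LHS]mxE [X in _ * X]mxE.
have e1 : wedge p l2 k2 a b = _ := wedge_lin4 _ _ _ _ _ _ _ _ a b.
have e2 : wedge p m2 m2' a b = _ := wedge_lin4 _ _ _ _ _ _ _ _ a b.
apply: etrans (esym (congr2 (fun u v => s * (u + v)) e1 e2)).
move=> {e1 e2}; cbv beta.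
have := det1C.
move: s (x^cj) (y^cj) (z^cj) (t^cj) (low l a) (low l b) (low k a) (low k b)
  (low m a) (low m b) (low m' a) (low m' b) => ? ? ? ? ? ? ? ? ? ? ? ? ? h.
ring: h.
Qed.

End Spinor.

Lemma spin_future x y : (x != 0) || (y != 0) ->
  dot p l (toC (future p)) < 0 ->
  dot p (lin4 (x * x^cj) (y * y^cj) (- (x^cj * y)) (- (x * y^cj)))
    (toC (future p)) < 0.
Proof.
move=> xy0; set f := toC (future p) => lf.
have ff : dot p f f < 0 by rewrite -future_dot; apply: future_timelike.
rewrite dot_self in ff.
have fR : conjm f = f by exact: conj_toC.
have aR : (dot p l f)^cj = dot p l f by rewrite -dot_conj lR fR.
have gR : (dot p m f)^cj = dot p m' f by rewrite -dot_conj mR fR.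
rewrite dot_lin4; move: lf ff aR gR.
move: (dot p l f) (dot p k f) (dot p m f) (dot p m' f) => a b c c' a0 ff aR cR.
have d0 : 0 < a * b - c * c'.
  rewrite -oppr_lt0 opprB.
  by move: ff; rewrite pmulr_rlt0 // ltr0n.
rewrite -(nmulr_rgt0 _ a0).
(* A sum of squares, by the reversed Cauchy-Schwarz inequality [d0]. *)
have -> : a * (x * x^cj * a + y * y^cj * b + - (x^cj * y) * c
      + - (x * y^cj) * c') =
    (a * x - y * c) * (a * x - y * c)^cj + y * y^cj * (a * b - c * c').
  have -> : (a * x - y * c)^cj = a * x^cj - y^cj * c'.
    by rewrite -{2}aR -cR -!conjcM -conjcN -(rmorphD conjc).
  by ring.
have [y0|y0] := eqVneq y 0.
  have x0 : x != 0 by move: xy0; rewrite y0 eqxx orbF.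
  rewrite y0 !mul0r subr0 addr0 lt0r mulcJ_ge0 andbT.
  by rewrite mulf_eq0 conjc_eq0 orbb mulf_neq0 // lt_eqF.
apply: ltr_wpDl; first exact: mulcJ_ge0.
by rewrite mulr_gt0 // lt0r mulcJ_ge0 andbT mulf_eq0 conjc_eq0 orbb.
Qed.

End NullBase.
End Tetrad.

Lemma null_base_spin (R : rcfType) (p : spacetime_point R) W U V
    (x y z t : R[i]) :
  null_bivector_base p W U V -> x * t - y * z = 1 ->
  null_bivector_base p
    (comb W U V (2 * (x * z), x * t + y * z, 2 * (y * t)))
    (comb W U V (x ^+ 2, x * y, y ^+ 2)) (comb W U V (z ^+ 2, z * t, t ^+ 2)).
Proof.
move=> [l0 [k0 [m [[fl fk nul uni ort] WE UE VE [sW sU sV]]]]] det1.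
have lR := conj_toC l0; have kR := conj_toC k0; have mR := erefl (map_mx conjc m).
have [c1 c2 c3] := spin_reality lR kR mR x y z t.
have [l2 e1] := real_vec c1; have [k2 e2] := real_vec c2.
have [dn [du dp]] := spin_dots lR kR mR nul uni ort det1.
have hU := spin_U WE UE VE det1; have hV := spin_V WE UE VE det1.
have hW := spin_W WE UE VE det1.
have xy : (x != 0) || (y != 0).
  apply: contraTT (oner_neq0 R[i]); rewrite negb_or !negbK -det1.
  by move=> /andP[/eqP -> /eqP ->]; rewrite !mul0r subrr eqxx.
have zt : (z != 0) || (t != 0).
  apply: contraTT (oner_neq0 R[i]); rewrite negb_or !negbK -det1.
  by move=> /andP[/eqP -> /eqP ->]; rewrite !mulr0 subrr eqxx.
have lf : dot p (toC l0) (toC (future p)) < 0 by rewrite -future_dot.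
have f1 := spin_future lR kR mR nul uni ort xy lf.
have f2 := spin_future lR kR mR nul uni ort zt lf.
have sd := self_dual_comb WE UE VE sW sU sV.
move: dn du dp hU hV hW f1 f2; rewrite e1 e2 -c3.
move: (lin4 _ _ _ _ _ _ _ _) => m2 dn du dp hU hV hW f1 f2.
exists l2, k2, m2; split=> //.
by split=> //; rewrite /future_pointing future_dot.
Qed.

(** * The Weyl tensor in a null bivector base *)

Section Base.
Variables (R : rcfType) (p : spacetime_point R) (W U V : 'M[R[i]]_4).
Local Notation C := R[i].
Local Notation vec := (C * C * C)%type.
Local Notation cb := (comb W U V).
Hypothesis hb : null_bivector_base p W U V.

Lemma base_ip v w : ip p (cb v) (cb w) = ip3 v w.
Proof.
have [l [k [m [[_ _ nul uni ort] WE UE VE _]]]] := hb.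
exact: (ip_comb (conj_toC l) (conj_toC k) erefl nul uni ort WE UE VE).
Qed.

(** Orthogonality removes the metric term of the product, which is not a 2-form. *)
Lemma base_cross v w : ip3 v w = 0 ->
  ('i * (Num.sqrt 2)%:C) *: cross p (cb v) (cb w) = cb (vee 'i v w).
Proof.
move=> vw.
have [l [k [m [[_ _ nul uni ort] WE UE VE _]]]] := hb.
have -> := cross_comb (conj_toC l) (conj_toC k) erefl nul uni ort WE UE VE v w.
by rewrite vw mulr0 scale0r subr0.
Qed.

Lemma base_inj : injective cb.
Proof.
have [l [k [m [[_ _ nul uni ort] WE UE VE _]]]] := hb.
exact: (comb_inj (conj_toC l) (conj_toC k) erefl nul uni ort WE UE VE).
Qed.

Lemma base_self_dual X : self_dual p X <-> exists v, X = cb v.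
Proof.
have [l [k [m [[_ _ nul uni ort] WE UE VE [sW sU sV]]]]] := hb.
split=> [|[v ->]].
  exact: (self_dual_span (conj_toC l) (conj_toC k) erefl nul uni ort WE UE VE).
exact: (self_dual_comb WE UE VE).
Qed.

Lemma base_U : U = cb (1, 0, 0).
Proof. by rewrite /comb /= !scale0r scale1r !addr0. Qed.

Lemma base_W : W = cb (0, 1, 0).
Proof. by rewrite /comb /= !scale0r scale1r add0r addr0. Qed.

Lemma base_V : V = cb (0, 0, 1).
Proof. by rewrite /comb /= !scale0r scale1r !add0r. Qed.

(** Pairing with the dual base (2 V, -W, 2 U). It makes sense on all matrices, over which the traces
    in [trI] and [trJ] are taken. *)
Definition coords X : vec := (2 * ip p V X, - ip p W X, 2 * ip p U X).

Lemma coordsK v : coords (cb v) = v.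
Proof.
have eV : ip p V (cb v) = ip3 (0, 0, 1) v by rewrite -base_ip -base_V.
have eW : ip p W (cb v) = ip3 (0, 1, 0) v by rewrite -base_ip -base_W.
have eU : ip p U (cb v) = ip3 (1, 0, 0) v by rewrite -base_ip -base_U.
rewrite /coords eU eV eW /ip3 /=.
by case: v {eU eV eW} => [[a b] c] /=; do ![congr (_, _)]; field.
Qed.

Definition linear3 (h : 'M[C]_4 -> vec) :=
  forall a X Y, h (a *: X + Y) = add3 (scale3 a (h X)) (h Y).

Lemma coords_linear : linear3 coords.
Proof.
move=> a X Y; rewrite /coords !ipPr /add3 /scale3 /=.
move: (ip p U X) (ip p U Y) (ip p V X) (ip p V Y) (ip p W X) (ip p W Y) => *.
by do ![congr (_, _)]; ring.
Qed.

Lemma sum_delta (F : 'M[C]_4 -> C) X :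
  (forall a X Y, F (a *: X + Y) = a * F X + F Y) ->
  F X = \sum_a \sum_b F (delta_mx a b) * X a b.
Proof.
move=> FP.
have F0 : F 0 = 0 by have := FP (-1) 0 0; rewrite scaler0 addr0 mulN1r addNr.
have FD Y Z : F (Y + Z) = F Y + F Z by rewrite -[Y]scale1r FP mul1r scale1r.
rewrite {1}[X]matrix_sum_delta (big_morph F FD F0); apply: eq_bigr => a _.
rewrite (big_morph F FD F0); apply: eq_bigr => b _.
by rewrite -[_ *: _]addr0 FP F0 addr0 mulrC.
Qed.

Lemma mxtrace_lin_mx (f : 'M[C]_4 -> 'M[C]_4) :
  \tr (lin_mx f) = \sum_a \sum_b f (delta_mx a b) a b.
Proof.
rewrite /mxtrace (reindex _ (curry_mxvec_bij _ _)) /= pair_bigA /=.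
apply: eq_bigr => -[a b] _ /=.
by rewrite !mxE /= mxvecE -mxvec_delta mxvecK.
Qed.

(** An instance of tr(AB) = tr(BA): the trace over the 16-dimensional space of matrices becomes that
    of the 3 by 3 operator [h] after [comb]. *)
Lemma mxtrace_comb (f : 'M[C]_4 -> 'M[C]_4) h : linear3 h ->
  (forall X, f X = cb (h X)) ->
  \tr (lin_mx f) = (h U).1.1 + (h W).1.2 + (h V).2.
Proof.
move=> hl fE.
have -> : (h U).1.1 = \sum_a \sum_b (h (delta_mx a b)).1.1 * U a b.
  by apply: (sum_delta (F := fun X => (h X).1.1)) => a X Y; rewrite hl.
have -> : (h W).1.2 = \sum_a \sum_b (h (delta_mx a b)).1.2 * W a b.
  by apply: (sum_delta (F := fun X => (h X).1.2)) => a X Y; rewrite hl.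
have -> : (h V).2 = \sum_a \sum_b (h (delta_mx a b)).2 * V a b.
  by apply: (sum_delta (F := fun X => (h X).2)) => a X Y; rewrite hl.
rewrite mxtrace_lin_mx -!big_split; apply: eq_bigr => a _ /=.
rewrite -!big_split; apply: eq_bigr => b _ /=.
by rewrite fE /comb !mxE.
Qed.

Variables (T : tensor4 R) (Psi : weyl_scalars R).
Hypothesis hc : components p T W U V Psi.

Lemma weyl_opE X : sd_weyl_op p T X = cb (weyl3 Psi (coords X)).
Proof.
apply/matrixP => a b.
pose Z := \matrix_(c, d) sd_weyl p T a b c d.
have -> : sd_weyl_op p T X a b = ip p Z X.
  rewrite /sd_weyl_op mxE /ip; congr (_ * _).
  apply: eq_bigr => c _; apply: eq_bigr => d _.
  by congr (_ * _); rewrite [RHS]mxE.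
have -> : Z =
    (2 * (Psi0 Psi * U a b + Psi1 Psi * W a b + Psi2 Psi * V a b)) *: U
  + (2 * (Psi1 Psi * U a b + Psi2 Psi * W a b + Psi3 Psi * V a b)) *: W
  + (2 * (Psi2 Psi * U a b + Psi3 Psi * W a b + Psi4 Psi * V a b)) *: V.
  apply/matrixP => c d; rewrite !mxE.
  have -> : sd_weyl p T a b c d = 2 * (2^-1 * sd_weyl p T a b c d) by field.
  by rewrite hc /sotimes /otimes; ring.
rewrite !ipDl !ipZl /comb !mxE /weyl3 /coords /=; ring.
Qed.

Lemma weyl_op_comb v : sd_weyl_op p T (cb v) = cb (weyl3 Psi v).
Proof. by rewrite weyl_opE coordsK. Qed.

Lemma weyl3_linear h : linear3 h -> linear3 (fun X => weyl3 Psi (h X)).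
Proof.
move=> hl a X Y; rewrite hl /weyl3 /add3 /scale3 /=.
by do ![congr (_, _)]; ring.
Qed.

(** The left side does not mention the base, so this and [trJ_inv] both transport type I to the
    scalars and equate the invariants of two bases. *)
Lemma trI_inv : trI p T = invI Psi.
Proof.
rewrite /trI (mxtrace_comb (h := fun X => weyl3 Psi (weyl3 Psi (coords X)))).
- have -> : coords U = (1, 0, 0) by rewrite {1}base_U coordsK.
  have -> : coords W = (0, 1, 0) by rewrite {1}base_W coordsK.
  have -> : coords V = (0, 0, 1) by rewrite {1}base_V coordsK.
  by rewrite /weyl3 /invI /=; field.
- do 2!apply: weyl3_linear; exact: coords_linear.
- by move=> X /=; rewrite (weyl_opE X) weyl_op_comb.
Qed.

Lemma trJ_inv : trJ p T = invJ Psi.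
Proof.
rewrite /trJ (mxtrace_comb
  (h := fun X => weyl3 Psi (weyl3 Psi (weyl3 Psi (coords X))))).
- have -> : coords U = (1, 0, 0) by rewrite {1}base_U coordsK.
  have -> : coords W = (0, 1, 0) by rewrite {1}base_W coordsK.
  have -> : coords V = (0, 0, 1) by rewrite {1}base_V coordsK.
  by rewrite /weyl3 invJE /=; field.
- do 3!apply: weyl3_linear; exact: coords_linear.
- by move=> X /=; rewrite (weyl_opE X) !weyl_op_comb.
Qed.

End Base.

(** * Eigenframes and their orientation in coordinates *)

Section Frames.
Variables (R : rcfType) (p : spacetime_point R) (W U V : 'M[R[i]]_4).
Local Notation C := R[i].
Local Notation vec := (C * C * C)%type.
Local Notation cb := (comb W U V).
Hypothesis hb : null_bivector_base p W U V.
Local Notation c0 := ('i * (Num.sqrt (2 : R))%:C : C).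

Lemma eigenframe_comb T Psi al v : components p T W U V Psi ->
  eigenframe p T al (fun n => cb (v n)) <->
  [/\ forall n, ip3 (v n) (v n) = -1,
      forall m n, m != n -> ip3 (v m) (v n) = 0
    & forall n, weyl3 Psi (v n) = scale3 (al n) (v n)].
Proof.
move=> hc; split=> [[_ u o e]|[u o e]]; split.
- by move=> n; rewrite -(base_ip hb) u.
- by move=> m n mn; rewrite -(base_ip hb) o.
- by move=> n; apply: (base_inj hb); rewrite -(weyl_op_comb hb hc) e comb_scale.
- by move=> n; apply/(base_self_dual hb); exists (v n).
- by move=> n; rewrite (base_ip hb) u.
- by move=> m n mn; rewrite (base_ip hb) o.
- by move=> n; rewrite (weyl_op_comb hb hc) e comb_scale.
Qed.

Lemma oriented_comb v : ip3 (v 0) (v 1) = 0 ->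
  oriented p (fun n => cb (v n)) <-> v 2 = vee 'i (v 0) (v 1).
Proof.
move=> v01; rewrite /oriented (base_cross hb v01).
by split=> [/(base_inj hb)|->].
Qed.

Lemma comb0 : cb (0, 0, 0) = 0.
Proof. by rewrite /comb /= !scale0r !addr0. Qed.

Lemma c0_i_s : c0 * ('i * (Num.sqrt (2 : R))^-1%:C) = -1.
Proof.
have nz : Num.sqrt (2 : R) != 0 by rewrite sqrtr_eq0 -ltNge ltr0n.
rewrite mulrACA -expr2 sqr_i -rmorphM mulfV // rmorph1 mulr1; reflexivity.
Qed.

Lemma base_cross_self v : ip3 v v = -1 ->
  c0 *: cross p (cb v) (cb v) =
  ('i * (Num.sqrt (2 : R))^-1%:C) *: toC (metric p).
Proof.
move=> vv.
have [l [k [m [[_ _ nul uni ort] WE UE VE _]]]] := hb.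
have -> := cross_comb (conj_toC l) (conj_toC k) erefl nul uni ort WE UE VE v v.
have -> : vee 'i v v = (0, 0, 0) by rewrite /vee; do ![congr (_, _)]; ring.
by rewrite comb0 sub0r vv mulrN1 scaleNr opprK.
Qed.

Lemma vee_anti (a b : vec) : vee 'i b a = scale3 (-1) (vee 'i a b).
Proof. by rewrite /vee /scale3 /=; do ![congr (_, _)]; ring. Qed.

Lemma crossZl a X Y : cross p (a *: X) Y = a *: cross p X Y.
Proof. by rewrite /cross -!scalemxAl. Qed.

Lemma crossZr a X Y : cross p X (a *: Y) = a *: cross p X Y.
Proof. by rewrite /cross -scalemxAr. Qed.

Lemma crossA X Y Z : cross p (cross p X Y) Z = cross p X (cross p Y Z).
Proof. by rewrite /cross !mulmxA. Qed.

Lemma cross_gr X : cross p X (toC (metric p)) = X.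
Proof. by rewrite /cross -mulmxA mul_ginv_g mulmx1. Qed.

Lemma cross_gl X : cross p (toC (metric p)) X = X.
Proof. by rewrite /cross mul_g_ginv mul1mx. Qed.

(* A unitary self-dual 2-form is invertible for [cross], its square being a
   multiple of the metric; so any two elements of an oriented triple determine
   the third. *)
Lemma oriented_third w i a b : oriented p w ->
  ip3 a a = -1 -> ip3 b b = -1 -> ip3 a b = 0 ->
  w (ordS i) = cb a -> w (ordS (ordS i)) = cb b -> w i = cb (vee 'i a b).
Proof.
move=> ow aa bb ab.
have ba : ip3 b a = 0 by rewrite ip3C.
suff key X : c0 *: cross p (cb b) (cb a) = - X -> X = cb (vee 'i a b).
  move: i; apply: ord3P; rewrite !ordS3E => wa wb.
  - apply: key; rewrite -wb ow crossZl -wa crossA -crossZr wa.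
    by rewrite (base_cross_self aa) crossZr cross_gr scalerA c0_i_s scaleN1r.
  - apply: key; rewrite -wa ow crossZr -crossA wb -crossZl (base_cross_self bb).
    by rewrite crossZl cross_gl scalerA c0_i_s scaleN1r.
  - by rewrite ow wa wb (base_cross hb ab).
move=> h; apply: oppr_inj; rewrite -h (base_cross hb ba) vee_anti comb_scale.
by rewrite scaleN1r.
Qed.

End Frames.

(** * Weyl scalars under a change of spinor frame, and spinors of null pairs *)

Section SpinComponents.
Variables (R : rcfType) (p : spacetime_point R) (T : tensor4 R).
Variables (W U V : 'M[R[i]]_4) (Psi : weyl_scalars R) (x y z t : R[i]).
Local Notation C := R[i].
Local Notation cb := (comb W U V).
Local Notation P0 := (Psi0 Psi).
Local Notation P1 := (Psi1 Psi).
Local Notation P2 := (Psi2 Psi).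
Local Notation P3 := (Psi3 Psi).
Local Notation P4 := (Psi4 Psi).

(* The scalars are the coefficients (divided by the binomial ones) of a binary
   quartic; [a], [b], [c], [d] is the inverse of the change of spinor frame. *)
Definition spin_scalars : weyl_scalars R :=
  let a := t in let b := - z in let c := - y in let d := x in
  WeylScalars
    (P0 * a ^+ 4 + 4 * P1 * a ^+ 3 * b + 6 * P2 * a ^+ 2 * b ^+ 2
       + 4 * P3 * a * b ^+ 3 + P4 * b ^+ 4)
    (P0 * a ^+ 3 * c + P1 * (a ^+ 3 * d + 3 * a ^+ 2 * b * c)
       + P2 * (3 * a ^+ 2 * b * d + 3 * a * b ^+ 2 * c)
       + P3 * (3 * a * b ^+ 2 * d + b ^+ 3 * c) + P4 * b ^+ 3 * d)
    (P0 * a ^+ 2 * c ^+ 2 + P1 * (2 * a ^+ 2 * c * d + 2 * a * b * c ^+ 2)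
       + P2 * (a ^+ 2 * d ^+ 2 + 4 * a * b * c * d + b ^+ 2 * c ^+ 2)
       + P3 * (2 * a * b * d ^+ 2 + 2 * b ^+ 2 * c * d) + P4 * b ^+ 2 * d ^+ 2)
    (P0 * a * c ^+ 3 + P1 * (3 * a * c ^+ 2 * d + b * c ^+ 3)
       + P2 * (3 * a * c * d ^+ 2 + 3 * b * c ^+ 2 * d)
       + P3 * (a * d ^+ 3 + 3 * b * c * d ^+ 2) + P4 * b * d ^+ 3)
    (P0 * c ^+ 4 + 4 * P1 * c ^+ 3 * d + 6 * P2 * c ^+ 2 * d ^+ 2
       + 4 * P3 * c * d ^+ 3 + P4 * d ^+ 4).

Lemma components_spin : components p T W U V Psi -> x * t - y * z = 1 ->
  components p T
    (cb (2 * (x * z), x * t + y * z, 2 * (y * t)))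
    (cb (x ^+ 2, x * y, y ^+ 2)) (cb (z ^+ 2, z * t, t ^+ 2)) spin_scalars.
Proof.
move=> hc det1 a b c d; rewrite hc /otimes /sotimes /otimes {hc}.
set U' := cb (x ^+ 2, _, _); set W' := cb (2 * _, _, _); set V' := cb _.
(* The inverse change of base, homogenised by the squared determinant; once it is substituted,
   matching the coefficients is a formal identity. *)
have E e f : [/\ U e f = t ^+ 2 * U' e f - t * y * W' e f + y ^+ 2 * V' e f,
    W e f = - 2 * t * z * U' e f + (x * t + y * z) * W' e f - 2 * x * y * V' e f
  & V e f = z ^+ 2 * U' e f - x * z * W' e f + x ^+ 2 * V' e f].
  rewrite /W' /U' /V' /comb !mxE /=.
  have h u : u = (x * t - y * z) ^+ 2 * u by rewrite det1 expr1n mul1r.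
  by split; rewrite [LHS]h; ring.
clearbody U' W' V'; have [-> -> ->] := E a b; have [-> -> ->] := E c d.
by rewrite /spin_scalars /=; ring.
Qed.

End SpinComponents.

(** Nullity says b^2 = a c, the equation of a conic; square roots x of a and y of c satisfy x y = b
    up to a sign, absorbed in y. *)
Lemma null_spinor (R : rcfType) (q : R[i] * R[i] * R[i]) :
  ip3 q q = 0 -> exists x y, q = (x ^+ 2, x * y, y ^+ 2).
Proof.
case: q => [[a b] c]; rewrite /ip3 /= => h.
have sq (u : R[i]) : exists x, u = x ^+ 2 by exists (sqrtc u); rewrite sqr_sqrtc.
have [[x xa] [y yc]] := (sq a, sq c).
rewrite {}xa {}yc in h *.
have e0 : (x * y) ^+ 2 - b ^+ 2 =
    2^-1 * (x ^+ 2 * y ^+ 2 + y ^+ 2 * x ^+ 2) - b * b by field.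
have : (x * y) ^+ 2 == b ^+ 2 by rewrite -subr_eq0 e0 h.
rewrite eqf_sqr => /orP[] /eqP e; first by exists x, y; rewrite e.
by exists x, (- y); rewrite sqrrN mulrN e opprK.
Qed.

(** The product of the two null vectors is half the squared determinant, which is therefore 1 or -1;
    changing (z, t) into (-z, -t) corrects the sign without changing [r]. *)
Lemma null_spinors (R : rcfType) (q r : R[i] * R[i] * R[i]) :
  ip3 q q = 0 -> ip3 r r = 0 -> ip3 q r = 2^-1 ->
  exists x y z t, [/\ x * t - y * z = 1, q = (x ^+ 2, x * y, y ^+ 2)
    & r = (z ^+ 2, z * t, t ^+ 2)].
Proof.
move=> /null_spinor[x [y ->]] /null_spinor[z [t ->]].
rewrite /ip3 /= => h.
have e : (x * t - y * z) ^+ 2 = 1 ^+ 2.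
  have -> : (x * t - y * z) ^+ 2 =
    2 * (2^-1 * (x ^+ 2 * t ^+ 2 + y ^+ 2 * z ^+ 2) - x * y * (z * t)) by field.
  by rewrite h mulfV ?two_neq0 // expr1n.
have /orP[/eqP e'|/eqP e'] : (x * t - y * z == 1) || (x * t - y * z == - 1).
  by rewrite -eqf_sqr e.
- by exists x, y, z, t.
- exists x, y, (- z), (- t); rewrite !sqrrN mulrNN; split=> //.
  by rewrite -[RHS]opprK -e'; ring.
Qed.

(** * Orthogonal unitary pairs and the corresponding null pairs *)

Section Transverse.
Variables (R : rcfType) (p : spacetime_point R) (T : tensor4 R).
Variables (W U V : 'M[R[i]]_4) (Psi : weyl_scalars R).
Local Notation C := R[i].
Local Notation vec := (C * C * C)%type.
Local Notation cb := (comb W U V).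
Variable j : C.
Hypothesis j2 : j ^+ 2 = -1.

Definition transU3 (a b : vec) := scale3 (j / 2) (add3 a (scale3 j b)).
Definition transV3 (a b : vec) := scale3 (j / 2) (add3 a (scale3 (- j) b)).

Lemma ip3_transU3 a b : ip3 a a = -1 -> ip3 b b = -1 -> ip3 a b = 0 ->
  [/\ ip3 (transU3 a b) (transU3 a b) = 0, ip3 (transV3 a b) (transV3 a b) = 0
    & ip3 (transU3 a b) (transV3 a b) = 2^-1].
Proof.
move=> aa bb ab.
have ip3Dl u v w : ip3 (add3 u v) w = ip3 u w + ip3 v w.
  by rewrite /ip3 /add3 /=; field.
have ip3Dr u v w : ip3 w (add3 u v) = ip3 w u + ip3 w v.
  by rewrite ip3C ip3Dl !(ip3C w).
have ba : ip3 b a = 0 by rewrite ip3C.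
by rewrite /transU3 /transV3 !(ip3Zl, ip3Zr, ip3Dl, ip3Dr) aa bb ab ba;
  split; field: j2.
Qed.

(** Together with [vee_spin], this shows that the third member of the frame is exactly the first
    element of the base obtained from the spinors of the null pair, with the right sign. *)
Lemma vee_transU3 a b :
  vee j a b = scale3 (- 2 * j) (vee j (transU3 a b) (transV3 a b)).
Proof.
rewrite /vee /transU3 /transV3 /scale3 /add3 /=.
case: a b => [[? ?] ?] [[? ?] ?] /=.
by do ![congr (_, _)]; field: j2.
Qed.

Lemma add_transU3 a b :
  add3 (scale3 (- j) (transU3 a b)) (scale3 (- j) (transV3 a b)) = a.
Proof.
rewrite /transU3 /transV3 /scale3 /add3 /=; case: a b => [[? ?] ?] [[? ?] ?] /=.
by do ![congr (_, _)]; field: j2.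
Qed.

Lemma vee_spin x y z t : x * t - y * z = 1 ->
  scale3 (- 2 * j) (vee j (x ^+ 2, x * y, y ^+ 2) (z ^+ 2, z * t, t ^+ 2)) =
  (2 * (x * z), x * t + y * z, 2 * (y * t)).
Proof.
move=> det1.
have h (u : C) : u = (x * t - y * z) * u by rewrite det1 mul1r.
rewrite /vee /scale3 /=; do ![congr (_, _)]; rewrite [RHS]h; field: j2.
all: done.
Qed.

(** [y] and [z] solve U = (j/2)(y + j z), V = (j/2)(y - j z): they are the unitary pair that a null
    base itself determines. *)
Let y : vec := (- j, 0, - j).
Let z : vec := (-1, 0, 1).

Lemma std_pair : [/\ vee j y z = (0, 1, 0), ip3 y y = -1, ip3 z z = -1
  & ip3 y z = 0].
Proof.
by rewrite /vee /ip3 /y /z /=; split; do ?[congr (_, _)]; field: j2.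
Qed.

Lemma std_transUV3 : transU3 y z = (1, 0, 0) /\ transV3 y z = (0, 0, 1).
Proof.
rewrite /transU3 /transV3 /scale3 /add3 /y /z /=.
by split; do ![congr (_, _)]; field: j2.
Qed.

(** C maps W to -2 (Psi1, Psi2, Psi3), while the outer coordinates of the image of U + V are Psi0 +
    Psi2 and Psi2 + Psi4. *)
Lemma transverse_eigen a b :
  weyl3 Psi (0, 1, 0) = scale3 a (0, 1, 0) ->
  weyl3 Psi (- j, 0, - j) = scale3 b (- j, 0, - j) ->
  transverse Psi /\ Psi0 Psi = Psi4 Psi.
Proof.
have jn0 : - j != 0 by rewrite oppr_eq0 -sqrf_eq0 j2 oppr_eq0 oner_eq0.
have n2 : - 2 != 0 :> C by rewrite oppr_eq0 two_neq0.
rewrite /weyl3 /scale3 /= !mulr0 !mulr1 !add0r !addr0 !subr0.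
move=> [h1 _ h3] [k1 _ k3]; split; first split.
- by apply: (mulfI n2); rewrite mulNr h1 mulr0.
- by apply: (mulfI n2); rewrite mulNr h3 mulr0.
apply: (mulIf jn0); apply: (addIr (Psi2 Psi * - j)).
by rewrite k1 -k3 addrC.
Qed.

End Transverse.

Lemma transverseU_comb (R : rcfType) (W U V : 'M[R[i]]_4) a b :
  transverseU (comb W U V a) (comb W U V b) = comb W U V (transU3 'i a b).
Proof.
rewrite /transverseU /transU3 comb_scale comb_add comb_scale; reflexivity.
Qed.

Lemma transverseV_comb (R : rcfType) (W U V : 'M[R[i]]_4) a b :
  transverseV (comb W U V a) (comb W U V b) = comb W U V (transV3 'i a b).
Proof.
rewrite /transverseV /transV3 comb_scale comb_add comb_scale scaleNr; reflexivity.
Qed.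

(** * The principal frames *)

Definition pick3 (A : Type) (i : 'I_3) (a b c : A) (n : 'I_3) : A :=
  if n == i then a else if n == ordS i then b else c.

Lemma pick3_0 A i (a b c : A) : pick3 i a b c i = a.
Proof. by rewrite /pick3 eqxx. Qed.

Lemma pick3_1 A i (a b c : A) : pick3 i a b c (ordS i) = b.
Proof. by rewrite /pick3 (negPf (ordS_neq i)) eqxx. Qed.

Lemma pick3_2 A i (a b c : A) : pick3 i a b c (ordS (ordS i)) = c.
Proof. by rewrite /pick3 (negPf (ordSS_neq i)) (negPf (ordS_neq _)). Qed.

Definition pick3E := (pick3_0, pick3_1, pick3_2).

Lemma eigenframe_ext (R : rcfType) (p : spacetime_point R) T al w w' :
  w' =1 w -> eigenframe p T al w -> eigenframe p T al w'.
Proof.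
move=> wE [s u o e]; split=> *; rewrite !wE;
  [exact: s|exact: u|exact: o|exact: e].
Qed.

Lemma eigen_coords (R : rcfType) (p : spacetime_point R) T W U V Psi a X u :
  null_bivector_base p W U V -> components p T W U V Psi ->
  sd_weyl_op p T X = a *: X -> X = comb W U V u ->
  weyl3 Psi u = scale3 a u.
Proof.
move=> hb hc eX XE; apply: (base_inj hb).
by rewrite -(weyl_op_comb hb hc) -XE eX XE comb_scale.
Qed.

Section Main.
Variables (R : rcfType) (p : spacetime_point R) (T : tensor4 R).
Variables (W U V : 'M[R[i]]_4) (Psi : weyl_scalars R) (beta : R[i]).
Local Notation C := R[i].
Local Notation cb := (comb W U V).
Local Notation al := (alpha Psi beta).
Hypothesis tI : type_I p T.
Hypothesis hb : null_bivector_base p W U V.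
Hypothesis hc : components p T W U V Psi.
Hypotheses (is_beta_beta : is_beta Psi beta) (beta_neq0 : beta != 0).

Lemma type_I_alpha : injective al.
Proof.
have [x xI xr] := tI.
apply: (alpha_inj is_beta_beta beta_neq0 xI) => n.
have := xr n; rewrite (trI_inv hb hc) (trJ_inv hb hc) => /eqP.
by rewrite -addrA -opprD subr_eq0 => /eqP.
Qed.

Let al_inj := type_I_alpha.
Let i2 := sqr_i R.

Lemma frame_cyclic v : frame3 Psi beta v -> oriented p (fun n => cb (v n)) ->
  cyclic3 'i v.
Proof.
move=> [u o e]; have v01 : ip3 (v 0) (v 1) = 0 by rewrite o.
move/(oriented_comb hb v01) => v2.
by apply: (vee_cyclic i2 (i := 2)); rewrite ?ordS3E.
Qed.

Lemma cyclic_oriented v : frame3 Psi beta v -> cyclic3 'i v ->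
  oriented p (fun n => cb (v n)).
Proof.
move=> [u o e] cyc; apply/(oriented_comb hb); first by rewrite o.
by have := cyc 0; rewrite !ordS3E.
Qed.

Lemma eigenframe_coords w : eigenframe p T al w -> oriented p w ->
  exists v, [/\ w =1 (fun n => cb (v n)), frame3 Psi beta v & cyclic3 'i v].
Proof.
move=> ew ow.
have /fin_all_exists[v wE] n : exists v, w n = cb v.
  by apply/(base_self_dual hb); case: ew.
have eE := eigenframe_ext (fun n => esym (wE n)) ew.
have fv : frame3 Psi beta v := proj1 (eigenframe_comb hb al v hc) eE.
exists v; split=> //; apply: frame_cyclic => //.
by rewrite /oriented -!wE.
Qed.

Lemma principal_formula_comb a r :
  r^-1 *: (coefA Psi a *: U + Defs.coefB Psi a *: W + Defs.coefC Psi a *: V) =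
  cb (scale3 r^-1 (principal3 Psi a)).
Proof. by rewrite comb_scale. Qed.

Lemma frame_of_two i a b :
  ip3 a a = -1 -> ip3 b b = -1 ->
  weyl3 Psi a = scale3 (al (ordS i)) a ->
  weyl3 Psi b = scale3 (al (ordS (ordS i))) b ->
  frame3 Psi beta (pick3 i (vee 'i a b) a b) /\
  cyclic3 'i (pick3 i (vee 'i a b) a b).
Proof.
move=> aa bb ea eb.
apply: (frame3_of_two i2 is_beta_beta beta_neq0 al_inj (i := i)).
- by apply: (ord3_ind (i := i)); rewrite ?eqxx // => _; rewrite !pick3E.
- by apply: (ord3_ind (i := i)); rewrite ?eqxx // => _; rewrite !pick3E.
- by rewrite !pick3E.
Qed.

Lemma eigenframe_exists : exists w, eigenframe p T al w /\ oriented p w.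
Proof.
have [i [C1 C2]] := coefC_neq0 is_beta_beta beta_neq0 al_inj.
have root := alpha_root is_beta_beta beta_neq0.
have unit n : Defs.coefC Psi (al n) != 0 -> exists u,
    ip3 u u = -1 /\ weyl3 Psi u = scale3 (al n) u.
  move=> Cn.
  have nz := mulf_neq0 (coefD_neq0 is_beta_beta beta_neq0 al_inj n) Cn.
  by have := principal3_unit (root n) nz (sqr_sqrtc _); eauto.
have [[a [aa ea]] [b [bb eb]]] := (unit _ C1, unit _ C2).
have [fv cv] := frame_of_two aa bb ea eb.
exists (fun n => cb (pick3 i (vee 'i a b) a b n)); split.
  exact/(eigenframe_comb hb).
exact: cyclic_oriented.
Qed.

(** From right to left, the formula determines two members whose C is nonzero, and orientation
    forces the remaining one, even where the quotient is meaningless. *)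
Lemma eigenframe_formula w : oriented p w ->
  eigenframe p T al w <->
  (forall i, principal_formula Psi W U V (al i) (w i)).
Proof.
move=> ow; split=> [ew i nz|hw].
  have [v [wE fv cv]] := eigenframe_coords ew ow.
  have [r r2 vE] := frame3_principal i2 is_beta_beta beta_neq0 al_inj fv cv nz.
  by exists r => //; rewrite principal_formula_comb wE vE.
have [i [C1 C2]] := coefC_neq0 is_beta_beta beta_neq0 al_inj.
have root := alpha_root is_beta_beta beta_neq0.
have unit n : Defs.coefC Psi (al n) != 0 -> exists u,
    [/\ w n = cb u, ip3 u u = -1 & weyl3 Psi u = scale3 (al n) u].
  move=> Cn.
  have nz := mulf_neq0 (coefD_neq0 is_beta_beta beta_neq0 al_inj n) Cn.
  have [r r2 wE] := hw n nz; have [u1 u2] := principal3_unit (root n) nz r2.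
  exists (scale3 r^-1 (principal3 Psi (al n))).
  by rewrite wE principal_formula_comb.
have [[a [wa aa ea]] [b [wb bb eb]]] := (unit _ C1, unit _ C2).
have [fv cv] := frame_of_two aa bb ea eb.
have ab : ip3 a b = 0.
  by apply: (eigen_orthogonal al_inj ea eb); rewrite eq_sym ordS_neq.
have wi := oriented_third hb ow aa bb ab wa wb.
apply: (eigenframe_ext (w := fun n => cb (pick3 i (vee 'i a b) a b n))).
  by apply: (ord3_ind (i := i)); rewrite !pick3E.
exact/(eigenframe_comb hb).
Qed.

Lemma eigenframe_transverse w i : eigenframe p T al w -> oriented p w ->
  let j := ordS i in let k := ordS j in
  principal_transverse_base p T
    (w i) (transverseU (w j) (w k)) (transverseV (w j) (w k)).
Proof.
move=> ew ow j k.
have [v [wE fv cv]] := eigenframe_coords ew ow.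
rewrite !wE transverseU_comb transverseV_comb.
have [u o e] := fv.
have jk : ip3 (v j) (v k) = 0 by rewrite o // eq_sym ordS_neq.
have [UU VV UV] := ip3_transU3 i2 (u j) (u k) jk.
have viE : v i = vee 'i (v j) (v k) by rewrite -cv ordS3.
have [x [y [z [t [det1 UE VE]]]]] := null_spinors UU VV UV.
have WE : v i = (2 * (x * z), x * t + y * z, 2 * (y * t)).
  by rewrite viE (vee_transU3 i2) UE VE vee_spin.
have hb' := null_base_spin hb det1; have hc' := components_spin hc det1.
rewrite -WE -UE -VE in hb' hc'.
split=> //; exists (spin_scalars Psi x y z t).
suff [? ?] : transverse (spin_scalars Psi x y z t) /\
  Psi0 (spin_scalars Psi x y z t) = Psi4 (spin_scalars Psi x y z t) by split.
have [_ _ _ ee] := ew.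
apply: (transverse_eigen i2 (a := al i) (b := al j)).
  by apply: (eigen_coords hb' hc' (ee i)); rewrite wE -base_W.
apply: (eigen_coords hb' hc' (ee j)).
(* In the new base the second member of the pair is -i (U + V), the vector tested by
   [transverse_eigen]. *)
rewrite wE -{1}[v j](add_transU3 i2 _ (v k)) comb_add !comb_scale /comb /=.
rewrite scale0r addr0; reflexivity.
Qed.

(** With Psi0 = Psi4 = q0 and Psi2 = q2, the vectors W', U' + V' and U' - V' are eigenvectors for -2
    q2, q2 + q0 and q2 - q0. The first eigenvalue selects [i]; the other two may be the remaining
    roots in either cyclic order, which produces the two alternatives. *)
Lemma transverse_eigenframe W' U' V' : principal_transverse_base p T W' U' V' ->
  exists w, exists i,
    let j := ordS i in let k := ordS j in
    [/\ eigenframe p T al w, oriented p w, W' = w i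
      & (U' = transverseU (w j) (w k) /\ V' = transverseV (w j) (w k)) \/
        (U' = transverseU (- w k) (w j) /\ V' = transverseV (- w k) (w j))].
Proof.
move=> [hb' [Psi' [hc' [P1 P3] P04]]].
have IE : invI Psi = invI Psi' by rewrite -(trI_inv hb hc) (trI_inv hb' hc').
have JE : invJ Psi = invJ Psi' by rewrite -(trJ_inv hb hc) (trJ_inv hb' hc').
set q0 := Psi4 Psi' in P04; set q2 := Psi2 Psi'.
have {}IE : invI Psi = q0 ^+ 2 + 3 * q2 ^+ 2.
  by rewrite IE /invI P1 P3 P04 -/q0 -/q2; ring.
have {}JE : invJ Psi = q0 ^+ 2 * q2 - q2 ^+ 3.
  by rewrite JE invJE P1 P3 P04 -/q0 -/q2; ring.
have [|i ai] := is_root_alpha is_beta_beta beta_neq0 (a := - 2 * q2).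
  by rewrite /is_root IE JE; ring.
pose y : C * C * C := (- 'i, 0, - 'i); pose z : C * C * C := (-1, 0, 1).
have wW : weyl3 Psi' (0, 1, 0) = scale3 (al i) (0, 1, 0).
  rewrite -ai /weyl3 /scale3 /= P1 P3 P04 -/q0 -/q2.
  by do ![congr (_, _)]; ring.
have wy : weyl3 Psi' y = scale3 (q2 + q0) y.
  by rewrite /y /weyl3 /scale3 /= P1 P3 P04 -/q0 -/q2; do ![congr (_, _)]; ring.
have wz : weyl3 Psi' z = scale3 (q2 - q0) z.
  by rewrite /z /weyl3 /scale3 /= P1 P3 P04 -/q0 -/q2; do ![congr (_, _)]; ring.
have build a b : vee 'i a b = (0, 1, 0) ->
    ip3 a a = -1 -> ip3 b b = -1 -> ip3 a b = 0 ->
    weyl3 Psi' a = scale3 (al (ordS i)) a ->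
    weyl3 Psi' b = scale3 (al (ordS (ordS i))) b ->
    let w n := comb W' U' V' (pick3 i (0, 1, 0) a b n) in
    [/\ eigenframe p T al w, oriented p w & W' = w i].
  move=> vab aa bb ab ea eb w.
  set v := pick3 i (0, 1, 0) a b.
  have Wa : ip3 (0, 1, 0) a = 0 by rewrite -vab ip3_veel.
  have Wb : ip3 (0, 1, 0) b = 0 by rewrite -vab ip3_veer.
  have WW : ip3 (0, 1, 0) (0, 1, 0) = -1 :> C.
    by rewrite -vab (ip3_vee i2) ab aa bb; ring.
  have vu : forall n, ip3 (v n) (v n) = -1.
    by apply: (ord3_ind (i := i)); rewrite /v !pick3E.
  have vo : forall m n, m != n -> ip3 (v m) (v n) = 0.
    apply: (ord3_ind (i := i)); apply: (ord3_ind (i := i));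
      rewrite /v ?eqxx ?pick3E //; by move=> _; rewrite ip3C.
  have ve : forall n, weyl3 Psi' (v n) = scale3 (al n) (v n).
    by apply: (ord3_ind (i := i)); rewrite /v !pick3E.
  have cv : cyclic3 'i v by apply: (vee_cyclic i2 (i := i)); rewrite /v !pick3E.
  split.
  - exact: (proj2 (eigenframe_comb hb' al v hc')).
  - apply: (proj2 (oriented_comb hb' _)); first by rewrite vo.
    by have := cv 0; rewrite !ordS3E.
  - by rewrite /w pick3E -base_W.
have [vyz yy zz yz] := std_pair i2; have [tUyz tVyz] := std_transUV3 i2.
rewrite -/y -/z in vyz yy zz yz tUyz tVyz.
have vzy : vee 'i z (scale3 (-1) y) = (0, 1, 0).
  by rewrite -vyz /vee /scale3 /=; do ![congr (_, _)]; ring.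
have U'E : U' = comb W' U' V' (transU3 'i y z) by rewrite tUyz -base_U.
have V'E : V' = comb W' U' V' (transV3 'i y z) by rewrite tVyz -base_V.
have sum : al (ordS i) + al (ordS (ordS i)) = 2 * q2.
  have := alpha_sum is_beta_beta beta_neq0 i; rewrite -ai -addrA => /eqP.
  by rewrite addr_eq0 => /eqP e; apply: oppr_inj; rewrite -e; ring.
(* The remaining roots have sum 2 q2 and product alpha_i^2 - I = q2^2 - q0^2. *)
have /eqP : (q2 + q0 - al (ordS i)) * (q2 + q0 - al (ordS (ordS i))) = 0.
  have -> : (q2 + q0 - al (ordS i)) * (q2 + q0 - al (ordS (ordS i))) =
    (q2 + q0) ^+ 2 - (q2 + q0) * (al (ordS i) + al (ordS (ordS i)))
     + al (ordS i) * al (ordS (ordS i)) by ring.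
  by rewrite sum (alpha_prod is_beta_beta beta_neq0) -ai IE; ring.
rewrite mulf_eq0 !subr_eq0 => /orP[] /eqP e1.
- have e2 : q2 - q0 = al (ordS (ordS i)).
    by apply: (addrI (al (ordS i))); rewrite sum -e1; ring.
  have [|||||| ew ow eW] := build y z; rewrite -?e1 -?e2 //.
  exists (fun n => comb W' U' V' (pick3 i (0, 1, 0) y z n)), i; split=> //.
  by left; rewrite !pick3E transverseU_comb transverseV_comb.
have e2 : q2 - q0 = al (ordS i).
  by apply: (addIr (al (ordS (ordS i)))); rewrite sum -e1; ring.
(* In the reversed order the pair is (z, -y), the sign keeping the product equal to W'. *)
have wy' : weyl3 Psi' (scale3 (-1) y) = scale3 (q2 + q0) (scale3 (-1) y).
  by rewrite /y /weyl3 /scale3 /= P1 P3 P04 -/q0 -/q2; do ![congr (_, _)]; ring.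
have [|||||| ew ow eW] := build z (scale3 (-1) y); rewrite -?e1 -?e2 //.
- by rewrite ip3Zl ip3Zr yy; ring.
- by rewrite ip3Zr ip3C yz; ring.
exists (fun n => comb W' U' V' (pick3 i (0, 1, 0) z (scale3 (-1) y) n)), i.
split=> //.
right; rewrite !pick3E comb_scale scaleN1r opprK.
by rewrite transverseU_comb transverseV_comb.
Qed.

End Main.

Theorem corollary1 (R : rcfType) (p : spacetime_point R) (T : tensor4 R)
    (W U V : 'M[R[i]]_4) (Psi : weyl_scalars R) (beta : R[i]) :
  is_weyl p T -> type_I p T ->
  null_bivector_base p W U V -> components p T W U V Psi ->
  is_beta Psi beta -> beta != 0 ->
  [/\ exists w : 'I_3 -> 'M[R[i]]_4,
        eigenframe p T (alpha Psi beta) w /\ oriented p w,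
      forall w : 'I_3 -> 'M[R[i]]_4, oriented p w ->
        (eigenframe p T (alpha Psi beta) w <->
         forall i, principal_formula Psi W U V (alpha Psi beta i) (w i)),
      forall w : 'I_3 -> 'M[R[i]]_4,
        eigenframe p T (alpha Psi beta) w -> oriented p w ->
        forall i, let j := ordS i in let k := ordS j in
          principal_transverse_base p T
            (w i) (transverseU (w j) (w k)) (transverseV (w j) (w k))
    & forall W' U' V' : 'M[R[i]]_4, principal_transverse_base p T W' U' V' ->
        exists w : 'I_3 -> 'M[R[i]]_4, exists i,
          let j := ordS i in let k := ordS j in
          [/\ eigenframe p T (alpha Psi beta) w, oriented p w, W' = w i
            & (U' = transverseU (w j) (w k) /\ V' = transverseV (w j) (w k)) \/
              (U' = transverseU (- w k) (w j) /\ V' = transverseV (- w k) (w j))]].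
Proof.
move=> _ tI hb hc hbeta beta0; split.
- exact: (eigenframe_exists tI hb hc hbeta beta0).
- by move=> w; exact: (eigenframe_formula tI hb hc hbeta beta0).
- by move=> w ew ow i; exact: (eigenframe_transverse hb hc i ew ow).
- exact: (transverse_eigenframe hb hc hbeta beta0).
Qed.
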